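(* Let $M$ be a meridian surface of type $\mathcal{M}''$, i.e. $z(u,v)=f(u)\,l(v)+g(u)\,e_4$ with $l$ a unit-speed (necessarily spacelike) curve on $\mathbb{H}^2_1(-1)\subset\mathrm{span}\{e_1,e_2,e_3\}$ (respectively, of type $\widetilde{\mathcal{M}}'$, i.e. $z(u,v)=g(u)\,e_1+f(u)\,l(v)$ with $l$ a unit-speed (necessarily timelike) curve on $\mathbb{S}^2_2(1)\subset\mathrm{span}\{e_2,e_3,e_4\}$), where $f'^2+g'^2=1$ and $g'\neq0$. Let $\kappa$ be the spherical curvature of $l$, and assume $\kappa\neq0$. Then $M$ has parallel normalized mean curvature vector field but not parallel mean curvature vector field if and only if one of the following cases holds: (i) $\kappa\neq0$ and the meridian is defined by $$f(u)=\pm\sqrt{u^2+2au+b},\qquad g(u)=\pm\sqrt{b-a^2}\,\ln\left|u+a+\sqrt{u^2+2au+b}\right|+c,$$ where $a=\mathrm{const}$, $b=\mathrm{const}$, $c=\mathrm{const}$, $b-a^2>0$. (ii) the curve $l$ has non-zero constant spherical curvature and the meridian is determined by $f'=\varphi(f)$, where $$\varphi(t)=\pm\frac1t\sqrt{t^2-(a-ct)^2},\qquad a=\mathrm{const},\quad c=\mathrm{const}\neq0,\quad c^2\neq\kappa^2,$$ and $g$ is defined by $g'=\sqrt{1-f'^2}$.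
   Context: Ambient space: $\mathbb{E}^4_2$ is $\mathbb{R}^4$ with the metric $\langle\cdot,\cdot\rangle=dx_1^2+dx_2^2-dx_3^2-dx_4^2$; $e_1,e_2,e_3,e_4$ is an orthonormal basis with $\langle e_1,e_1\rangle=\langle e_2,e_2\rangle=1$, $\langle e_3,e_3\rangle=\langle e_4,e_4\rangle=-1$. A vector $v$ is spacelike if $\langle v,v\rangle>0$ or $v=0$, timelike if $\langle v,v\rangle<0$. Meridian surfaces: $f,g$ are smooth real functions on an interval $I$, $f$ nowhere zero; $l$ is a smooth curve on an interval $J$; $u\in I$, $v\in J$. The curve $u\mapsto(f(u),g(u))$ is called the meridian. Type $\mathcal{M}''$: $z(u,v)=f(u)l(v)+g(u)e_4$, where $l(v)=\sinh w^1\cos w^2\,e_1+\sinh w^1\sin w^2\,e_2+\cosh w^1\,e_3$ with $w^1=w^1(v)$, $w^2=w^2(v)$ smooth, a curve on $\mathbb{H}^2_1(-1)=\{V\in\mathrm{span}\{e_1,e_2,e_3\}:\langle V,V\rangle=-1\}$ with $\langle l',l'\rangle=1$, and $f'^2+g'^2=1$. The first fundamental form is $E=-1$, $F=0$, $G=f^2$. Type $\widetilde{\mathcal{M}}'$: $z(u,v)=g(u)e_1+f(u)l(v)$, where $l(v)=\cosh w^1\,e_2+\sinh w^1\cos w^2\,e_3+\sinh w^1\sin w^2\,e_4$ with $w^1,w^2$ smooth functions of $v$, a curve on $\mathbb{S}^2_2(1)=\{V\in\mathrm{span}\{e_2,e_3,e_4\}:\langle V,V\rangle=1\}$ with $\langle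 l',l'\rangle=-1$, and $f'^2+g'^2=1$. The first fundamental form is $E=1$, $F=0$, $G=-f^2$. Both are Lorentz surfaces (induced metric of signature $(1,1)$). Spherical curvature: let $t=l'$ and let $n(v)$ be the vector field, unique up to sign, in the 3-dimensional space containing $l$, such that $\{l,t,n\}$ is an orthonormal frame. The spherical curvature of $l$ is $\kappa(v)=\langle t'(v),n(v)\rangle$. Mean curvature: $h$ is the second fundamental form, $H=\tfrac12\,\mathrm{tr}\,h$ is the mean curvature vector field, $D$ is the normal connection. The surface has parallel mean curvature vector field if $DH=0$ identically. It has parallel normalized mean curvature vector field if $H$ is non-zero, $\langle H,H\rangle\neq0$, and there is a unit vector field $b$ in the direction of $H$ which is parallel in the normal bundle, i.e. $Db=0$ identically.
   Formalization: In (ii), f is required to be non-constant (for constant f, H is parallel, so ''if'' fails); the sign in f'=±φ(f) may vary from point to point (turning points of f); g'=√(1−f'²) is taken up to one global sign, since g'<0 is allowed. *)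

(* Defs.v *)
From Stdlib Require Import Reals.
From Coquelicot Require Import Coquelicot.
Open Scope R_scope.

Definition is_open_interval (I : R -> Prop) : Prop :=
  open I /\ (exists x, I x) /\
  forall x y t, I x -> I y -> x <= t <= y -> I t.

(* [ex_derive_n f n x] only depends on [f] near [x]; since the domains are
   open, the values of the total function [f] outside [I] are irrelevant. *)
Definition smooth_on (I : R -> Prop) (f : R -> R) : Prop :=
  forall n x, I x -> ex_derive_n f n x.

Definition E42 : NormedModule R_AbsRing :=
  prod_NormedModule _
    (prod_NormedModule _ (prod_NormedModule _ R_NormedModule R_NormedModule)
       R_NormedModule) R_NormedModule.

Definition vec (a b c d : R) : E42 := (a, b, c, d).

Definition x1 (x : E42) : R := fst (fst (fst x)).
Definition x2 (x : E42) : R := snd (fst (fst x)).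
Definition x3 (x : E42) : R := snd (fst x).
Definition x4 (x : E42) : R := snd x.

Definition e1 : E42 := vec 1 0 0 0.
Definition e2 : E42 := vec 0 1 0 0.
Definition e3 : E42 := vec 0 0 1 0.
Definition e4 : E42 := vec 0 0 0 1.

Definition inner (x y : E42) : R :=
  x1 x * x1 y + x2 x * x2 y - x3 x * x3 y - x4 x * x4 y.

(* Unit vectors may be spacelike or timelike. *)
Definition unit_vector (x : E42) : Prop := inner x x = 1 \/ inner x x = -1.

Definition orthonormal3 (x y z : E42) : Prop :=
  unit_vector x /\ unit_vector y /\ unit_vector z /\
  inner x y = 0 /\ inner x z = 0 /\ inner y z = 0.

Definition in_span3 (p q r x : E42) : Prop :=
  exists a b c : R, x = plus (plus (scal a p) (scal b q)) (scal c r).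

Definition smooth_curve_on (J : R -> Prop) (c : R -> E42) : Prop :=
  smooth_on J (fun t => x1 (c t)) /\ smooth_on J (fun t => x2 (c t)) /\
  smooth_on J (fun t => x3 (c t)) /\ smooth_on J (fun t => x4 (c t)).

Definition vderive (c : R -> E42) (t : R) : E42 :=
  vec (Derive (fun s => x1 (c s)) t) (Derive (fun s => x2 (c s)) t)
      (Derive (fun s => x3 (c s)) t) (Derive (fun s => x4 (c s)) t).

Definition du (X : R -> R -> E42) (u v : R) : E42 := vderive (fun s => X s v) u.
Definition dv (X : R -> R -> E42) (u v : R) : E42 := vderive (fun s => X u s) v.

Definition fffE (z : R -> R -> E42) (u v : R) : R :=
  inner (du z u v) (du z u v).
Definition fffF (z : R -> R -> E42) (u v : R) : R :=
  inner (du z u v) (dv z u v).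
Definition fffG (z : R -> R -> E42) (u v : R) : R :=
  inner (dv z u v) (dv z u v).
Definition fffW (z : R -> R -> E42) (u v : R) : R :=
  fffE z u v * fffG z u v - fffF z u v ^ 2.

(* Component of [x] orthogonal to span(z_u, z_v). The tangential coefficients
   solve the linear system given by the Gram matrix (E F; F G), which is
   invertible exactly when the induced metric is non-degenerate. *)
Definition normal_part (z : R -> R -> E42) (u v : R) (x : E42) : E42 :=
  let p := inner x (du z u v) in
  let q := inner x (dv z u v) in
  minus x
    (plus
       (scal ((fffG z u v * p - fffF z u v * q) / fffW z u v) (du z u v))
       (scal ((fffE z u v * q - fffF z u v * p) / fffW z u v) (dv z u v))).

(* Gauss formula: h(X, Y) is the normal part of the derivative of Y along X. *)
Definition h_uu (z : R -> R -> E42) (u v : R) : E42 :=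
  normal_part z u v (du (du z) u v).
Definition h_uv (z : R -> R -> E42) (u v : R) : E42 :=
  normal_part z u v (du (dv z) u v).
Definition h_vv (z : R -> R -> E42) (u v : R) : E42 :=
  normal_part z u v (dv (dv z) u v).

(* H = (1/2) tr h, the trace being taken with respect to the induced metric,
   whose inverse matrix is (G -F; -F E) / W. *)
Definition mean_curvature (z : R -> R -> E42) (u v : R) : E42 :=
  scal (1 / 2)
    (plus
       (plus (scal (fffG z u v / fffW z u v) (h_uu z u v))
             (scal (- 2 * fffF z u v / fffW z u v) (h_uv z u v)))
       (scal (fffE z u v / fffW z u v) (h_vv z u v))).

(* [xi] is meant to be a normal vector field; D is the normal connection. *)
Definition D_u (z xi : R -> R -> E42) (u v : R) : E42 :=
  normal_part z u v (du xi u v).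
Definition D_v (z xi : R -> R -> E42) (u v : R) : E42 :=
  normal_part z u v (dv xi u v).

Definition parallel_normal_field (I J : R -> Prop) (z xi : R -> R -> E42)
  : Prop :=
  forall u v, I u -> J v -> D_u z xi u v = zero /\ D_v z xi u v = zero.

Definition parallel_mean_curvature (I J : R -> Prop) (z : R -> R -> E42)
  : Prop :=
  parallel_normal_field I J z (mean_curvature z).

(* A unit field which is a positive multiple of H is H / sqrt |<H,H>| on
   I x J, hence smooth there as soon as [z] is: no separate regularity
   condition on [b] is needed. *)
Definition parallel_normalized_mean_curvature (I J : R -> Prop)
  (z : R -> R -> E42) : Prop :=
  (forall u v, I u -> J v ->
     mean_curvature z u v <> zero /\
     inner (mean_curvature z u v) (mean_curvature z u v) <> 0) /\
  exists b : R -> R -> E42,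
    (forall u v, I u -> J v ->
       unit_vector (b u v) /\
       exists lam : R, 0 < lam /\ b u v = scal lam (mean_curvature z u v)) /\
    parallel_normal_field I J z b.

(* The suffixes _M2 and _Mt1 stand for the types M'' and M-tilde'. *)
Definition l_M2 (w1 w2 : R -> R) (v : R) : E42 :=
  plus (plus (scal (sinh (w1 v) * cos (w2 v)) e1)
             (scal (sinh (w1 v) * sin (w2 v)) e2))
       (scal (cosh (w1 v)) e3).

Definition z_M2 (f g w1 w2 : R -> R) (u v : R) : E42 :=
  plus (scal (f u) (l_M2 w1 w2 v)) (scal (g u) e4).

Definition l_Mt1 (w1 w2 : R -> R) (v : R) : E42 :=
  plus (plus (scal (cosh (w1 v)) e2)
             (scal (sinh (w1 v) * cos (w2 v)) e3))
       (scal (sinh (w1 v) * sin (w2 v)) e4).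

Definition z_Mt1 (f g w1 w2 : R -> R) (u v : R) : E42 :=
  plus (scal (g u) e1) (scal (f u) (l_Mt1 w1 w2 v)).

(* [n] is a smooth choice, unique up to a global sign, of the third vector of
   the frame {l, t = l', n} inside the 3-space [V] containing [l]. *)
Definition spherical_normal (V : E42 -> Prop) (J : R -> Prop) (l n : R -> E42)
  : Prop :=
  smooth_curve_on J n /\
  forall v, J v -> V (n v) /\ orthonormal3 (l v) (vderive l v) (n v).

Definition spherical_curvature (l n : R -> E42) (v : R) : R :=
  inner (vderive (vderive l) v) (n v).

Definition is_sign (s : R) : Prop := s = 1 \/ s = -1.

Definition case_i (I J : R -> Prop) (f g kappa : R -> R) : Prop :=
  (forall v, J v -> kappa v <> 0) /\
  exists a b c s1 s2 : R,
    b - a ^ 2 > 0 /\ is_sign s1 /\ is_sign s2 /\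
    forall u, I u ->
      f u = s1 * sqrt (u ^ 2 + 2 * a * u + b) /\
      g u = s2 * sqrt (b - a ^ 2)
               * ln (Rabs (u + a + sqrt (u ^ 2 + 2 * a * u + b))) + c.

Definition phi (a c t : R) : R := 1 / t * sqrt (t ^ 2 - (a - c * t) ^ 2).

(* The sign in f' = +-phi(f) depends on the point: it changes where f passes
   through a local extremum. The sign in g' = +-sqrt(1 - f'^2) is global and
   corresponds to the reflection g -> -g. The constant solutions of the
   equation f' = +-phi(f), for which H is parallel, are left out. *)
Definition case_ii (I J : R -> Prop) (f g kappa : R -> R) : Prop :=
  exists a c k : R,
    c <> 0 /\ k <> 0 /\ c ^ 2 <> k ^ 2 /\
    (forall v, J v -> kappa v = k) /\
    (exists u1 u2, I u1 /\ I u2 /\ f u1 <> f u2) /\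
    (forall u, I u ->
       0 <= f u ^ 2 - (a - c * f u) ^ 2 /\
       exists s, is_sign s /\ Derive f u = s * phi a c (f u)) /\
    (exists s, is_sign s /\
       forall u, I u -> Derive g u = s * sqrt (1 - Derive f u ^ 2)).

(* Main.v *)
Require Import Defs.
From Stdlib Require Import Reals Lra Psatz Classical.
From Coquelicot Require Import Coquelicot.
Open Scope R_scope.

(** Both types of surfaces have the form [z = f l + g e], where [{l, t, n, e}],
    [t = l'], is an orthonormal frame along the curve [l] with
    [<l,l> = <e,e> = - eps] and [<t,t> = <n,n> = eps]; the sign [eps] is [1]
    for the first type and [-1] for the second.  Everything is computed in the
    coordinates of this frame ([comb]), where the Frenet equations read
    [t' = l + eps kappa n] and [n' = - eps kappa t].

    The normal bundle is spanned by [n] and [n2 = - g' l + f' e], and both are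
    parallel for the normal connection ([normal_connection]).  With
    [m = f (f' g'' - g' f'') + g'], called [bend] below,
    [H = kappa / (2 f) n - eps m / (2 f) n2]
    ([mean_curvature_formula]).  A field in the direction of [H] with unit
    length is therefore parallel exactly when the ratio of the two coefficients
    of [H] is constant, and such a field exists exactly when [H] is nowhere
    lightlike; together this says [m(u) = r kappa(v)] for a constant [r] with
    [r^2 <> 1] ([proportional_of_parallel_normalized] and its converse).
    As [kappa] has no zero, [H] itself can be parallel only if [f] is constant.

    The variables [u] and [v] being separated, either [r = 0] and [m = 0], or
    [m] and [kappa] are non-zero constants.  The equation for [m] is integrated
    by means of the two identities that follow from [f'^2 + g'^2 = 1], namely
    [f' m = (f g')'] and [g' m = g'^2 - f f''].

    If [m = 0], the second identity becomes [(f f')' = 1], so [f^2] is a monic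
    quadratic polynomial and [g'] is a constant multiple of [1 / f].  If
    [m = - c], the first becomes [(f g' + c f)' = 0], so [f g' = a - c f] and
    [f'^2 = 1 - g'^2] is the equation [f' = +-phi(f)].  Conversely that
    equation gives [f g' = s (a - c f)] for a fixed sign [s], hence
    [f' (m - d) = 0] with [d = - s c], and it remains to exclude that [f] be
    stationary on part of the interval with another value of [m] there:
    this is [bend_rigid]. *)

(** * Calculus on an open interval *)

Lemma is_derive_eq (f : R -> R) (x l l' : R) :
  is_derive f x l -> l = l' -> is_derive f x l'.
Proof. intros H <-; exact H. Qed.

Lemma is_derive_times (f g : R -> R) (x df dg : R) :
  is_derive f x df -> is_derive g x dg ->
  is_derive (fun t => f t * g t) x (df * g x + f x * dg).
Proof.
  intros Hf Hg. apply (is_derive_mult f g x df dg Hf Hg Rmult_comm).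
Qed.

Lemma is_derive_add (f g : R -> R) (x df dg : R) :
  is_derive f x df -> is_derive g x dg ->
  is_derive (fun t => f t + g t) x (df + dg).
Proof. intros Hf Hg. apply (is_derive_plus f g x df dg Hf Hg). Qed.

Lemma is_derive_sub (f g : R -> R) (x df dg : R) :
  is_derive f x df -> is_derive g x dg ->
  is_derive (fun t => f t - g t) x (df - dg).
Proof. intros Hf Hg. apply (is_derive_minus f g x df dg Hf Hg). Qed.

Lemma is_derive_neg (f : R -> R) (x df : R) :
  is_derive f x df -> is_derive (fun t => - f t) x (- df).
Proof. intros Hf. apply (is_derive_opp f x df Hf). Qed.

Lemma is_derive_square (f : R -> R) (x df : R) :
  is_derive f x df -> is_derive (fun t => f t ^ 2) x (2 * f x * df).
Proof.
  intros Hf. eapply is_derive_eq; [apply (is_derive_pow f 2 x df Hf)|].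
  simpl; ring.
Qed.

Lemma is_derive_quot (f g : R -> R) (x df dg : R) :
  is_derive f x df -> is_derive g x dg -> g x <> 0 ->
  is_derive (fun t => f t / g t) x ((df * g x - f x * dg) / g x ^ 2).
Proof. intros Hf Hg H. apply (is_derive_div f g x df dg Hf Hg H). Qed.

Lemma is_derive_cst (a x : R) : is_derive (fun _ => a) x 0.
Proof. apply (is_derive_const a x). Qed.

Lemma is_derive_var (x : R) : is_derive (fun t => t) x 1.
Proof. apply (is_derive_id x). Qed.

(** The rule is chosen from the syntax of the function: unification alone would
    try to unfold [Rabs], [sqrt] and [Derive].  Derivatives of the atoms are
    taken from the hypotheses. *)
Ltac derive_rules :=
  lazymatch goal with
  | |- is_derive (fun t => _ * _) _ _ => eapply is_derive_times; derive_rules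
  | |- is_derive (fun t => _ + _) _ _ => eapply is_derive_add; derive_rules
  | |- is_derive (fun t => _ - _) _ _ => eapply is_derive_sub; derive_rules
  | |- is_derive (fun t => - _) _ _ => eapply is_derive_neg; derive_rules
  | |- is_derive (fun t => _ ^ 2) _ _ => eapply is_derive_square; derive_rules
  | |- is_derive (fun t => _ / _) _ _ =>
      eapply is_derive_quot; [derive_rules | derive_rules | try assumption]
  | |- is_derive (Rmult ?a) ?x ?l =>
      change (is_derive (fun t => a * t) x l); derive_rules
  | |- is_derive (fun t => t) _ _ => apply is_derive_var
  | |- is_derive (fun _ => ?a) _ _ => apply is_derive_cst
  | |- _ => eassumption
  end.
Ltac derive_to := eapply is_derive_eq; [derive_rules | cbv beta].

Lemma locally_in_interval (I : R -> Prop) (u : R) :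
  is_open_interval I -> I u -> locally u I.
Proof. intros [HI _] Hu. exact (HI u Hu). Qed.

Lemma constant_on_interval (I : R -> Prop) (h : R -> R) :
  is_open_interval I -> (forall u, I u -> is_derive h u 0) ->
  forall u v, I u -> I v -> h u = h v.
Proof.
  intros (_ & _ & Hc) Hh.
  assert (H : forall u v, I u -> I v -> u < v -> h u = h v).
  { intros u v Hu Hv Huv.
    apply (eq_is_derive (V := R_NormedModule) h u v); [|exact Huv].
    intros t Ht. apply Hh. exact (Hc u v t Hu Hv Ht). }
  intros u v Hu Hv. destruct (Rtotal_order u v) as [Huv|[->|Huv]].
  - now apply H.
  - reflexivity.
  - symmetry; now apply H.
Qed.

Lemma sign_on_interval (I : R -> Prop) (h : R -> R) :
  is_open_interval I -> (forall u, I u -> ex_derive h u) ->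
  (forall u, I u -> h u <> 0) ->
  exists s, is_sign s /\ forall u, I u -> 0 < s * h u.
Proof.
  intros HI Hh H0. pose proof HI as (_ & (u0 & Hu0) & _).
  (* The derivative of |h| / h vanishes. *)
  assert (Hc : forall u, I u -> Rabs (h u) / h u = Rabs (h u0) / h u0).
  { intros u Hu.
    apply (constant_on_interval I (fun t => Rabs (h t) / h t)); auto.
    intros t Ht. pose proof (H0 t Ht) as Hn.
    pose proof (Derive_correct h t (Hh t Ht)) as Hd.
    pose proof (is_derive_Rabs h t _ Hd Hn) as Ha.
    derive_to.
    destruct (Rlt_or_le (h t) 0) as [Hl|Hl].
    - rewrite (sign_eq_m1 _ Hl), (Rabs_left _ Hl). field; auto.
    - rewrite (sign_eq_1 (h t)) by lra. rewrite Rabs_right by lra.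
      field; auto. }
  assert (Hs : is_sign (Rabs (h u0) / h u0)).
  { pose proof (H0 u0 Hu0) as Hn. unfold is_sign.
    destruct (Rlt_or_le (h u0) 0) as [Hl|Hl].
    - right. rewrite (Rabs_left _ Hl). field; auto.
    - left. rewrite Rabs_right by lra. field; auto. }
  exists (Rabs (h u0) / h u0). split; [exact Hs|].
  intros u Hu. rewrite <- (Hc u Hu).
  replace (Rabs (h u) / h u * h u) with (Rabs (h u))
    by (field; apply H0; exact Hu).
  apply Rabs_pos_lt. apply H0; exact Hu.
Qed.

Lemma sign_cases (s x : R) :
  is_sign s -> 0 < s * x -> s ^ 2 = 1 /\ s * x = Rabs x /\ x = s * Rabs x.
Proof.
  intros [->| ->] H.
  - rewrite Rabs_right by lra. repeat split; ring.
  - rewrite Rabs_left by lra. repeat split; ring.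
Qed.

Lemma is_sign_square (s : R) : is_sign s -> s ^ 2 = 1.
Proof. intros [->| ->]; ring. Qed.

Lemma sign_nonzero (s : R) : is_sign s -> s <> 0.
Proof. intros [->| ->]; lra. Qed.

(** * Unit speed meridians *)

Record meridian (I : R -> Prop) (f g : R -> R) : Prop := {
  mer_int : is_open_interval I;
  mer_f : smooth_on I f;
  mer_g : smooth_on I g;
  mer_f0 : forall u, I u -> f u <> 0;
  mer_arc : forall u, I u -> Derive f u ^ 2 + Derive g u ^ 2 = 1;
  mer_g0 : forall u, I u -> Derive g u <> 0 }.

(** With [k] the signed curvature of the meridian, this is [f k + g']: up to
    the factor [1 / (2 f)] and a sign, the component of the mean curvature
    vector along the normal of the meridian. *)
Definition bend (f g : R -> R) (u : R) : R :=
  f u * (Derive f u * Derive (Derive g) u - Derive g u * Derive (Derive f) u)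
  + Derive g u.

Lemma smooth_derivatives (I : R -> Prop) (f : R -> R) (u : R) :
  smooth_on I f -> I u ->
  is_derive f u (Derive f u) /\
  is_derive (Derive f) u (Derive (Derive f) u) /\
  is_derive (Derive (Derive f)) u (Derive (Derive (Derive f)) u).
Proof.
  intros Hf Hu. split; [|split]; apply Derive_correct.
  - exact (Hf 1%nat u Hu).
  - exact (Hf 2%nat u Hu).
  - exact (Hf 3%nat u Hu).
Qed.

Lemma derive_unique (f : R -> R) (u a b : R) :
  is_derive f u a -> is_derive f u b -> a = b.
Proof.
  intros Ha Hb. apply is_derive_unique in Ha, Hb. congruence.
Qed.

Lemma is_derive_congr (I : R -> Prop) (h k : R -> R) (u d : R) :
  is_open_interval I -> I u -> (forall t, I t -> h t = k t) ->
  is_derive h u d -> is_derive k u d.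
Proof.
  intros HI Hu Hhk. apply is_derive_ext_loc.
  generalize (locally_in_interval I u HI Hu). apply filter_imp. exact Hhk.
Qed.


Lemma meridian_acceleration (I : R -> Prop) (f g : R -> R) (u : R) :
  meridian I f g -> I u ->
  Derive f u * Derive (Derive f) u + Derive g u * Derive (Derive g) u = 0.
Proof.
  intros M Hu.
  destruct (smooth_derivatives I f u (mer_f _ _ _ M) Hu) as (F1 & F2 & _).
  destruct (smooth_derivatives I g u (mer_g _ _ _ M) Hu) as (G1 & G2 & _).
  assert (H : is_derive (fun t => Derive f t ^ 2 + Derive g t ^ 2) u
    (2 * Derive f u * Derive (Derive f) u
     + 2 * Derive g u * Derive (Derive g) u)) by derive_rules.
  assert (H' : is_derive (fun t => Derive f t ^ 2 + Derive g t ^ 2) u 0).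
  { apply (is_derive_congr I (fun _ => 1)); auto.
    - apply (mer_int _ _ _ M).
    - intros t Ht. now rewrite (mer_arc _ _ _ M t Ht).
    - apply is_derive_cst. }
  pose proof (derive_unique _ _ _ _ H H'). lra.
Qed.

(** [f' bend] is the derivative of [f g'], since [f' k = g''] for the curvature
    [k] of a unit speed curve. *)
Lemma bend_times_derive_f (I : R -> Prop) (f g : R -> R) (u : R) :
  meridian I f g -> I u ->
  Derive f u * bend f g u
  = Derive f u * Derive g u + f u * Derive (Derive g) u.
Proof.
  intros M Hu. pose proof (meridian_acceleration I f g u M Hu) as Ha.
  pose proof (mer_arc _ _ _ M u Hu) as Hb. unfold bend.
  replace (Derive f u * (f u * (Derive f u * Derive (Derive g) u
      - Derive g u * Derive (Derive f) u) + Derive g u)) with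
    (Derive f u * Derive g u + f u * Derive (Derive g) u *
       (Derive f u ^ 2 + Derive g u ^ 2)
     - f u * Derive g u * (Derive f u * Derive (Derive f) u
         + Derive g u * Derive (Derive g) u)) by ring.
  rewrite Ha, Hb. ring.
Qed.

(** The companion identity, from [g' k = - f'']. *)
Lemma bend_times_derive_g (I : R -> Prop) (f g : R -> R) (u : R) :
  meridian I f g -> I u ->
  Derive g u * bend f g u = Derive g u ^ 2 - f u * Derive (Derive f) u.
Proof.
  intros M Hu. pose proof (meridian_acceleration I f g u M Hu) as Ha.
  pose proof (mer_arc _ _ _ M u Hu) as Hb. unfold bend.
  replace (Derive g u * (f u * (Derive f u * Derive (Derive g) u
      - Derive g u * Derive (Derive f) u) + Derive g u)) with
    (Derive g u ^ 2 - f u * Derive (Derive f) u *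
       (Derive f u ^ 2 + Derive g u ^ 2)
     + f u * Derive f u * (Derive f u * Derive (Derive f) u
         + Derive g u * Derive (Derive g) u)) by ring.
  rewrite Ha, Hb. ring.
Qed.

Lemma is_derive_bend (I : R -> Prop) (f g : R -> R) (u : R) :
  meridian I f g -> I u ->
  is_derive (bend f g) u
    (Derive f u * (Derive f u * Derive (Derive g) u
                   - Derive g u * Derive (Derive f) u)
     + f u * (Derive f u * Derive (Derive (Derive g)) u
              - Derive g u * Derive (Derive (Derive f)) u)
     + Derive (Derive g) u).
Proof.
  intros M Hu.
  destruct (smooth_derivatives I f u (mer_f _ _ _ M) Hu) as (F1 & F2 & F3).
  destruct (smooth_derivatives I g u (mer_g _ _ _ M) Hu) as (G1 & G2 & G3).
  unfold bend. derive_to. ring.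
Qed.

Lemma derive_nonzero_of_nonconstant (I : R -> Prop) (f g : R -> R) :
  meridian I f g -> (exists u1 u2, I u1 /\ I u2 /\ f u1 <> f u2) ->
  exists u, I u /\ Derive f u <> 0.
Proof.
  intros M (u1 & u2 & H1 & H2 & H12). apply NNPP. intros Hn. apply H12.
  apply (constant_on_interval I f); auto; [apply (mer_int _ _ _ M)|].
  intros u Hu.
  destruct (smooth_derivatives I f u (mer_f _ _ _ M) Hu) as (F1 & _).
  eapply is_derive_eq; [exact F1|].
  apply NNPP. intros Hd. apply Hn. now exists u.
Qed.

(** * Meridians of vanishing bend *)

(** In arc length parametrization, the catenary
    [f = +- p cosh ((g - q) / p)] with [p = sqrt (b - a ^ 2)]. *)
Definition catenary (I : R -> Prop) (f g : R -> R) : Prop :=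
  exists a b c s1 s2 : R,
    b - a ^ 2 > 0 /\ is_sign s1 /\ is_sign s2 /\
    forall u, I u ->
      f u = s1 * sqrt (u ^ 2 + 2 * a * u + b) /\
      g u = s2 * sqrt (b - a ^ 2)
               * ln (Rabs (u + a + sqrt (u ^ 2 + 2 * a * u + b))) + c.

Lemma quadratic_pos (a b u : R) :
  b - a ^ 2 > 0 ->
  0 < u ^ 2 + 2 * a * u + b /\ 0 < u + a + sqrt (u ^ 2 + 2 * a * u + b).
Proof.
  intros H.
  assert (Hq : 0 < u ^ 2 + 2 * a * u + b)
    by (pose proof (pow2_ge_0 (u + a)); nra).
  split; [exact Hq|].
  pose proof (sqrt_lt_R0 _ Hq) as Hs.
  pose proof (sqrt_sqrt _ (Rlt_le _ _ Hq)) as Hs2.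
  set (s := sqrt (u ^ 2 + 2 * a * u + b)) in *.
  destruct (Rlt_or_le 0 (u + a + s)) as [Hl|Hl]; [exact Hl|].
  assert (s * s <= (u + a) ^ 2) by nra. lra.
Qed.

Lemma is_derive_sqrt_quadratic (a b u : R) :
  b - a ^ 2 > 0 ->
  is_derive (fun t => sqrt (t ^ 2 + 2 * a * t + b)) u
    ((u + a) / sqrt (u ^ 2 + 2 * a * u + b)).
Proof.
  intros H. destruct (quadratic_pos a b u H) as [Hq _].
  assert (Hd : is_derive (fun t => t ^ 2 + 2 * a * t + b) u (2 * u + 2 * a)).
  { derive_to. simpl. ring. }
  eapply is_derive_eq; [apply (is_derive_sqrt _ u _ Hd Hq)|].
  pose proof (sqrt_lt_R0 _ Hq). field. lra.
Qed.

Lemma is_derive_log_quadratic (a b u : R) :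
  b - a ^ 2 > 0 ->
  is_derive (fun t => ln (Rabs (t + a + sqrt (t ^ 2 + 2 * a * t + b)))) u
    (1 / sqrt (u ^ 2 + 2 * a * u + b)).
Proof.
  intros H. destruct (quadratic_pos a b u H) as [Hq Hp].
  pose proof (is_derive_sqrt_quadratic a b u H) as Hd.
  apply (is_derive_ext
    (fun t => ln (t + a + sqrt (t ^ 2 + 2 * a * t + b)))).
  { intros t. destruct (quadratic_pos a b t H) as [_ Ht].
    rewrite Rabs_right by lra. reflexivity. }
  assert (Hi : is_derive (fun t => t + a + sqrt (t ^ 2 + 2 * a * t + b)) u
     (1 + 0 + (u + a) / sqrt (u ^ 2 + 2 * a * u + b))) by derive_rules.
  eapply is_derive_eq.
  - apply (is_derive_comp (K := R_AbsRing) ln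
      (fun t => t + a + sqrt (t ^ 2 + 2 * a * t + b)) u _ _
      (is_derive_ln _ Hp) Hi).
  - pose proof (sqrt_lt_R0 _ Hq) as Hs.
    set (s := sqrt (u ^ 2 + 2 * a * u + b)) in *.
    change ((1 + 0 + (u + a) / s) * / (u + a + s) = 1 / s).
    field. lra.
Qed.

(** Here [f f'' = g'^2 = 1 - f'^2], that is [(f f')' = 1], so [f^2] is a
    quadratic polynomial; then [(f g')^2 = f^2 - (f f')^2] is the constant
    [b - a^2]. *)
Lemma catenary_of_bend_zero (I : R -> Prop) (f g : R -> R) :
  meridian I f g -> (forall u, I u -> bend f g u = 0) -> catenary I f g.
Proof.
  intros M Hb. pose proof (mer_int _ _ _ M) as HI.
  pose proof HI as (_ & (u0 & Hu0) & _).
  set (a := f u0 * Derive f u0 - u0).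
  assert (Ha : forall u, I u -> f u * Derive f u = u + a).
  { intros u Hu. unfold a.
    enough (f u * Derive f u - u = f u0 * Derive f u0 - u0) by lra.
    apply (constant_on_interval I (fun t => f t * Derive f t - t)); auto.
    intros t Ht.
    destruct (smooth_derivatives I f t (mer_f _ _ _ M) Ht) as (F1 & F2 & _).
    derive_to. pose proof (bend_times_derive_g I f g t M Ht) as Hg.
    rewrite (Hb t Ht) in Hg. pose proof (mer_arc _ _ _ M t Ht). lra. }
  set (b := f u0 ^ 2 - u0 ^ 2 - 2 * a * u0).
  assert (Hf2 : forall u, I u -> f u ^ 2 = u ^ 2 + 2 * a * u + b).
  { intros u Hu. unfold b.
    enough (f u ^ 2 - u ^ 2 - 2 * a * u = f u0 ^ 2 - u0 ^ 2 - 2 * a * u0)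
      by lra.
    apply (constant_on_interval I (fun t => f t ^ 2 - t ^ 2 - 2 * a * t)); auto.
    intros t Ht.
    destruct (smooth_derivatives I f t (mer_f _ _ _ M) Ht) as (F1 & _ & _).
    derive_to. pose proof (Ha t Ht). lra. }
  assert (Hfg : forall u, I u -> (f u * Derive g u) ^ 2 = b - a ^ 2).
  { intros u Hu. pose proof (mer_arc _ _ _ M u Hu) as Hu1.
    pose proof (Ha u Hu) as Hu2. pose proof (Hf2 u Hu) as Hu3.
    replace ((f u * Derive g u) ^ 2) with
      (f u ^ 2 * (Derive f u ^ 2 + Derive g u ^ 2) - (f u * Derive f u) ^ 2)
      by ring.
    rewrite Hu1, Hu2, Hu3. ring. }
  assert (Hpos : b - a ^ 2 > 0).
  { rewrite <- (Hfg u0 Hu0).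
    assert (f u0 * Derive g u0 <> 0)
      by (apply Rmult_integral_contrapositive_currified;
          [apply (mer_f0 _ _ _ M) | apply (mer_g0 _ _ _ M)]; exact Hu0).
    nra. }
  assert (HF : forall u, I u -> ex_derive f u)
    by (intros u Hu; exact (mer_f _ _ _ M 1%nat u Hu)).
  assert (HG : forall u, I u -> ex_derive (Derive g) u)
    by (intros u Hu; exact (mer_g _ _ _ M 2%nat u Hu)).
  destruct (sign_on_interval I f HI HF (mer_f0 _ _ _ M)) as (s1 & Hs1 & Hs1').
  destruct (sign_on_interval I (Derive g) HI HG (mer_g0 _ _ _ M))
    as (s2 & Hs2 & Hs2').
  assert (Habs : forall u, I u -> Rabs (f u) = sqrt (u ^ 2 + 2 * a * u + b)).
  { intros u Hu. rewrite <- (Hf2 u Hu), <- sqrt_Rsqr_abs. f_equal.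
    unfold Rsqr. ring. }
  exists a, b, (g u0 - s2 * sqrt (b - a ^ 2)
    * ln (Rabs (u0 + a + sqrt (u0 ^ 2 + 2 * a * u0 + b)))), s1, s2.
  repeat split; auto.
  - rewrite <- (Habs u H). apply (sign_cases s1 (f u)); auto.
  - enough (g u - s2 * sqrt (b - a ^ 2)
              * ln (Rabs (u + a + sqrt (u ^ 2 + 2 * a * u + b)))
            = g u0 - s2 * sqrt (b - a ^ 2)
              * ln (Rabs (u0 + a + sqrt (u0 ^ 2 + 2 * a * u0 + b)))) by lra.
    apply (constant_on_interval I (fun t => g t - s2 * sqrt (b - a ^ 2)
              * ln (Rabs (t + a + sqrt (t ^ 2 + 2 * a * t + b))))); auto.
    intros t Ht.
    destruct (smooth_derivatives I g t (mer_g _ _ _ M) Ht) as (G1 & _ & _).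
    pose proof (is_derive_log_quadratic a b t Hpos) as L1.
    derive_to. rewrite <- (Habs t Ht).
    destruct (sign_cases s2 _ Hs2 (Hs2' t Ht)) as (_ & _ & ->).
    rewrite <- (Hfg t Ht).
    replace ((f t * Derive g t) ^ 2) with (Rsqr (f t * Derive g t))
      by (unfold Rsqr; ring).
    rewrite sqrt_Rsqr_abs, Rabs_mult. field.
    apply Rabs_no_R0. apply (mer_f0 _ _ _ M t Ht).
Qed.

(** The reverse computation; [f] is not constant because [f f' = u + a]. *)
Lemma bend_zero_of_catenary (I : R -> Prop) (f g : R -> R) :
  meridian I f g -> catenary I f g ->
  (forall u, I u -> bend f g u = 0) /\
  exists u1 u2, I u1 /\ I u2 /\ f u1 <> f u2.
Proof.
  intros M (a & b & c & s1 & s2 & Hpos & Hs1 & Hs2 & Hfg).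
  pose proof (mer_int _ _ _ M) as HI.
  assert (Ha : forall u, I u -> f u * Derive f u = u + a).
  { intros u Hu.
    assert (Hd : is_derive f u
      (s1 * ((u + a) / sqrt (u ^ 2 + 2 * a * u + b)))).
    { apply (is_derive_congr I
        (fun t => s1 * sqrt (t ^ 2 + 2 * a * t + b))); auto.
      - intros t Ht. symmetry. apply (Hfg t Ht).
      - pose proof (is_derive_sqrt_quadratic a b u Hpos). derive_to. ring. }
    apply is_derive_unique in Hd. rewrite Hd, (proj1 (Hfg u Hu)).
    destruct (quadratic_pos a b u Hpos) as [Hq _].
    pose proof (sqrt_lt_R0 _ Hq).
    transitivity (s1 ^ 2 * (u + a)).
    - field. lra.
    - rewrite (is_sign_square _ Hs1). ring. }
  split.
  - intros u Hu.
    destruct (smooth_derivatives I f u (mer_f _ _ _ M) Hu) as (F1 & F2 & _).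
    assert (H1 : is_derive (fun t => f t * Derive f t) u
      (Derive f u * Derive f u + f u * Derive (Derive f) u)) by derive_rules.
    assert (H2 : is_derive (fun t => f t * Derive f t) u 1).
    { apply (is_derive_congr I (fun t => t + a)); auto.
      - intros t Ht. now rewrite (Ha t Ht).
      - derive_to. ring. }
    pose proof (derive_unique _ _ _ _ H1 H2) as H12.
    pose proof (bend_times_derive_g I f g u M Hu) as Hb.
    pose proof (mer_arc _ _ _ M u Hu).
    apply (Rmult_eq_reg_l (Derive g u)); [|apply (mer_g0 _ _ _ M u Hu)].
    lra.
  - apply NNPP. intros Hn.
    pose proof HI as (_ & (u0 & Hu0) & _).
    (* A constant [f] would give u + a = 0 on the whole interval. *)
    assert (Hc : forall u, I u -> u + a = 0).
    { intros u Hu. rewrite <- (Ha u Hu).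
      assert (H0 : is_derive f u 0).
      { apply (is_derive_congr I (fun _ => f u)); auto.
        - intros t Ht. apply NNPP. intros Hd. apply Hn. now exists u, t.
        - apply is_derive_cst. }
      apply is_derive_unique in H0. rewrite H0. ring. }
    assert (H1 : is_derive (fun u : R => u + a) u0 0).
    { apply (is_derive_congr I (fun _ => 0)); auto.
      - intros t Ht. symmetry. apply (Hc t Ht).
      - apply is_derive_cst. }
    assert (H2 : is_derive (fun u : R => u + a) u0 (1 + 0)) by derive_rules.
    pose proof (derive_unique _ _ _ _ H1 H2). lra.
Qed.

(** * Meridians of non-zero constant bend *)

Definition phi_meridian (I : R -> Prop) (f g : R -> R) (a c : R) : Prop :=
  (exists u1 u2, I u1 /\ I u2 /\ f u1 <> f u2) /\
  (forall u, I u ->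
     0 <= f u ^ 2 - (a - c * f u) ^ 2 /\
     exists s, is_sign s /\ Derive f u = s * phi a c (f u)) /\
  (exists s, is_sign s /\
     forall u, I u -> Derive g u = s * sqrt (1 - Derive f u ^ 2)).

(** The function [f g' + c f] has derivative [f' (bend + c) = 0]; its value is
    the constant [a] of the equation. *)
Lemma phi_of_bend_constant (I : R -> Prop) (f g : R -> R) (c : R) :
  meridian I f g -> (forall u, I u -> bend f g u = - c) ->
  (exists u1 u2, I u1 /\ I u2 /\ f u1 <> f u2) ->
  exists a, phi_meridian I f g a c.
Proof.
  intros M Hb Hnc. pose proof (mer_int _ _ _ M) as HI.
  pose proof HI as (_ & (u0 & Hu0) & _).
  set (a := f u0 * Derive g u0 + c * f u0).
  assert (Ha : forall u, I u -> a - c * f u = f u * Derive g u).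
  { intros u Hu. unfold a.
    enough (f u * Derive g u + c * f u = f u0 * Derive g u0 + c * f u0) by lra.
    apply (constant_on_interval I (fun t => f t * Derive g t + c * f t)); auto.
    intros t Ht.
    destruct (smooth_derivatives I f t (mer_f _ _ _ M) Ht) as (F1 & _ & _).
    destruct (smooth_derivatives I g t (mer_g _ _ _ M) Ht) as (_ & G2 & _).
    derive_to. pose proof (bend_times_derive_f I f g t M Ht) as Hf.
    rewrite (Hb t Ht) in Hf. lra. }
  exists a. split; [exact Hnc|split].
  - intros u Hu. unfold phi. rewrite (Ha u Hu).
    pose proof (mer_arc _ _ _ M u Hu) as Hu1.
    pose proof (mer_f0 _ _ _ M u Hu) as Hf0.
    replace (f u ^ 2 - (f u * Derive g u) ^ 2) with (Rsqr (f u * Derive f u)).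
    2:{ unfold Rsqr. replace (Derive g u) with (Derive g u * 1) by ring.
        transitivity (f u ^ 2 * (1 - Derive g u ^ 2)); [|ring].
        rewrite <- Hu1. ring. }
    split; [apply Rle_0_sqr|]. rewrite sqrt_Rsqr_abs.
    destruct (Rlt_or_le (f u * Derive f u) 0) as [Hl|Hl].
    + exists (-1). split; [now right|]. rewrite (Rabs_left _ Hl). field; auto.
    + exists 1. split; [now left|]. rewrite Rabs_right by lra. field; auto.
  - assert (HG : forall u, I u -> ex_derive (Derive g) u)
      by (intros u Hu; exact (mer_g _ _ _ M 2%nat u Hu)).
    destruct (sign_on_interval I (Derive g) HI HG (mer_g0 _ _ _ M))
      as (s & Hs & Hs').
    exists s. split; [exact Hs|]. intros u Hu.
    pose proof (mer_arc _ _ _ M u Hu) as Hu1.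
    replace (1 - Derive f u ^ 2) with (Rsqr (Derive g u))
      by (unfold Rsqr; lra).
    rewrite sqrt_Rsqr_abs. apply (sign_cases s (Derive g u)); auto.
Qed.

(** A function [f] that is stationary on part of [I] leaves [bend] undetermined
    there by the hypothesis.  Smoothness excludes this: where [bend] differs
    from [d], [f'] vanishes nearby, so that [bend] is locally constant.  Hence
    the square of [bend - d] has zero derivative on all of [I], and it is zero
    at a point with [f' <> 0]. *)
Lemma bend_rigid (I : R -> Prop) (f g : R -> R) (d : R) :
  meridian I f g -> (exists u1 u2, I u1 /\ I u2 /\ f u1 <> f u2) ->
  (forall u, I u -> Derive f u * (bend f g u - d) = 0) ->
  forall u, I u -> bend f g u = d.
Proof.
  intros M Hnc Hfb u Hu. pose proof (mer_int _ _ _ M) as HI.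
  destruct (derive_nonzero_of_nonconstant I f g M Hnc) as (u1 & Hu1 & Hd1).
  assert (Hc : (bend f g u - d) ^ 2 = (bend f g u1 - d) ^ 2).
  { apply (constant_on_interval I (fun t => (bend f g t - d) ^ 2)); auto.
    intros t Ht. pose proof (is_derive_bend I f g t M Ht) as Hb.
    derive_to.
    destruct (Req_dec (bend f g t - d) 0) as [Hz|Hz]; [rewrite Hz; ring|].
    assert (Hloc : locally t (fun s => Derive f s = 0)).
    { assert (Hcont : continuous (fun s => bend f g s - d) t).
      { apply (ex_derive_continuous (K := R_AbsRing) (V := R_NormedModule)).
        eexists. derive_rules. }
      assert (Hne : locally (bend f g t - d) (fun y => y <> 0))
        by (apply open_neq; exact Hz).
      assert (Hloc : locally t (fun s => bend f g s - d <> 0))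
        by exact (Hcont _ Hne).
      generalize (filter_and _ _ Hloc (locally_in_interval I t HI Ht)).
      apply filter_imp. intros s [Hs1 Hs2].
      destruct (Rmult_integral _ _ (Hfb s Hs2)) as [H|H]; [exact H|].
      contradiction. }
    assert (H2 : locally t (fun s => Derive (Derive f) s = 0)).
    { generalize (locally_locally _ _ Hloc). apply filter_imp. intros s Hs.
      rewrite (Derive_ext_loc _ (fun _ => 0) s Hs). apply Derive_const. }
    assert (H3 : Derive (Derive (Derive f)) t = 0).
    { rewrite (Derive_ext_loc _ (fun _ => 0) t H2). apply Derive_const. }
    apply locally_singleton in Hloc. apply locally_singleton in H2.
    assert (H4 : Derive (Derive g) t = 0).
    { pose proof (meridian_acceleration I f g t M Ht) as Ha.
      rewrite Hloc in Ha.
      apply (Rmult_eq_reg_l (Derive g t)); [lra|apply (mer_g0 _ _ _ M t Ht)]. }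
    rewrite Hloc, H2, H3, H4. ring. }
  assert (H1 : bend f g u1 - d = 0).
  { destruct (Rmult_integral _ _ (Hfb u1 Hu1)) as [H|H]; tauto. }
  rewrite H1 in Hc.
  assert (bend f g u - d = 0); [|lra].
  apply Rsqr_0_uniq. unfold Rsqr. lra.
Qed.

(** The equation for [f'] only gives [(f g')^2 = (a - c f)^2]; neither side
    vanishes, so [f g' = s (a - c f)] with one sign [s] on the whole interval,
    and differentiating this yields [f' bend = - s c f']. *)
Lemma bend_constant_of_phi (I : R -> Prop) (f g : R -> R) (a c : R) :
  meridian I f g -> phi_meridian I f g a c ->
  exists s, is_sign s /\ forall u, I u -> bend f g u = s * c.
Proof.
  intros M (Hnc & Hphi & _). pose proof (mer_int _ _ _ M) as HI.
  assert (Hsq : forall u, I u -> (f u * Derive g u) ^ 2 = (a - c * f u) ^ 2).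
  { intros u Hu. destruct (Hphi u Hu) as (Hnn & s & Hs & Hf).
    pose proof (mer_arc _ _ _ M u Hu) as Hu1.
    pose proof (mer_f0 _ _ _ M u Hu) as Hf0.
    assert (H : (f u * Derive f u) ^ 2 = f u ^ 2 - (a - c * f u) ^ 2).
    { rewrite Hf. unfold phi.
      rewrite <- (sqrt_sqrt _ Hnn) at 2.
      transitivity (s ^ 2 * (sqrt (f u ^ 2 - (a - c * f u) ^ 2)
        * sqrt (f u ^ 2 - (a - c * f u) ^ 2))).
      - field; auto.
      - rewrite (is_sign_square _ Hs). ring. }
    transitivity (f u ^ 2 * (Derive f u ^ 2 + Derive g u ^ 2)
      - (f u * Derive f u) ^ 2); [ring|]. rewrite Hu1, H. ring. }
  assert (Hne : forall u, I u -> f u * Derive g u <> 0).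
  { intros u Hu. apply Rmult_integral_contrapositive_currified;
      [apply (mer_f0 _ _ _ M) | apply (mer_g0 _ _ _ M)]; exact Hu. }
  (* The product of the two sides, rather than their quotient: it is enough to
     know its sign, and it is visibly differentiable. *)
  destruct (sign_on_interval I
    (fun u => (f u * Derive g u) * (a - c * f u)) HI) as (s & Hs & Hs').
  { intros u Hu.
    destruct (smooth_derivatives I f u (mer_f _ _ _ M) Hu) as (F1 & _ & _).
    destruct (smooth_derivatives I g u (mer_g _ _ _ M) Hu) as (_ & G2 & _).
    eexists. derive_rules. }
  { intros u Hu H0. pose proof (Hsq u Hu). pose proof (Hne u Hu) as Hn.
    destruct (Rmult_integral _ _ H0) as [H1|H1]; [contradiction|].
    rewrite H1 in H. apply Hn. apply Rsqr_0_uniq. unfold Rsqr. lra. }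
  assert (Hfg : forall u, I u -> f u * Derive g u = s * (a - c * f u)).
  { intros u Hu. pose proof (Hsq u Hu) as H1. pose proof (Hs' u Hu) as H2.
    pose proof (Hne u Hu) as H3.
    apply Rminus_diag_uniq.
    assert (H4 : (f u * Derive g u - s * (a - c * f u))
                 * (f u * Derive g u + s * (a - c * f u)) = 0).
    { transitivity ((f u * Derive g u) ^ 2 - s ^ 2 * (a - c * f u) ^ 2);
        [ring|]. rewrite (is_sign_square _ Hs), H1. ring. }
    destruct (Rmult_integral _ _ H4) as [H5|H5]; [exact H5|].
    exfalso.
    assert (H6 : f u * Derive g u = - (s * (a - c * f u))) by lra.
    assert (H7 : s * (f u * Derive g u * (a - c * f u))
                 = - (s * (a - c * f u)) ^ 2) by (rewrite H6; ring).
    pose proof (pow2_ge_0 (s * (a - c * f u))). lra. }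
  exists (- s). split; [destruct Hs as [->| ->]; [right|left]; ring|].
  intros u Hu. apply (bend_rigid I f g (- s * c) M Hnc); [|exact Hu].
  clear u Hu. intros u Hu.
  destruct (smooth_derivatives I f u (mer_f _ _ _ M) Hu) as (F1 & _ & _).
  destruct (smooth_derivatives I g u (mer_g _ _ _ M) Hu) as (_ & G2 & _).
  assert (H1 : is_derive (fun t => f t * Derive g t) u
    (Derive f u * Derive g u + f u * Derive (Derive g) u)) by derive_rules.
  assert (H2 : is_derive (fun t => f t * Derive g t) u
                 (s * - (c * Derive f u))).
  { apply (is_derive_congr I (fun t => s * (a - c * f t))); auto.
    - intros t Ht. now rewrite (Hfg t Ht).
    - derive_to. ring. }
  pose proof (derive_unique _ _ _ _ H1 H2) as H12.
  pose proof (bend_times_derive_f I f g u M Hu). lra.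
Qed.

(** * Curves and frames in the ambient space *)

Lemma vec_ext (x y : E42) :
  x1 x = x1 y -> x2 x = x2 y -> x3 x = x3 y -> x4 x = x4 y -> x = y.
Proof.
  destruct x as [[[a b] c] d], y as [[[a' b'] c'] d']. cbn.
  now intros -> -> -> ->.
Qed.

Lemma inner_comm (x y : E42) : inner x y = inner y x.
Proof. unfold inner. ring. Qed.

Lemma inner_plus_l (x y z : E42) : inner (plus x y) z = inner x z + inner y z.
Proof.
  destruct x as [[[? ?] ?] ?], y as [[[? ?] ?] ?].
  unfold inner; cbn; ring.
Qed.

Lemma inner_scal_l (a : R) (x z : E42) : inner (scal a x) z = a * inner x z.
Proof. destruct x as [[[? ?] ?] ?]. unfold inner; cbn; ring. Qed.

Lemma inner_plus_r (x y z : E42) : inner z (plus x y) = inner z x + inner z y.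
Proof. now rewrite !(inner_comm z), inner_plus_l. Qed.

Lemma inner_scal_r (a : R) (x z : E42) : inner z (scal a x) = a * inner z x.
Proof. now rewrite !(inner_comm z), inner_scal_l. Qed.

Lemma inner_zero_l (x : E42) : inner zero x = 0.
Proof. unfold inner; cbn; ring. Qed.

Definition is_vderive (c : R -> E42) (t : R) (d : E42) : Prop :=
  is_derive (fun s => x1 (c s)) t (x1 d) /\
  is_derive (fun s => x2 (c s)) t (x2 d) /\
  is_derive (fun s => x3 (c s)) t (x3 d) /\
  is_derive (fun s => x4 (c s)) t (x4 d).

Lemma vderive_eq (c : R -> E42) (t : R) (d : E42) :
  is_vderive c t d -> vderive c t = d.
Proof.
  intros (H1 & H2 & H3 & H4). apply vec_ext; now apply is_derive_unique.
Qed.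

Lemma is_vderive_congr (I : R -> Prop) (c d : R -> E42) (t : R) (x : E42) :
  is_open_interval I -> I t -> (forall s, I s -> c s = d s) ->
  is_vderive c t x -> is_vderive d t x.
Proof.
  intros HI Ht Hcd (H1 & H2 & H3 & H4).
  refine (conj _ (conj _ (conj _ _)));
    (eapply (is_derive_congr I); [exact HI|exact Ht| |eassumption];
     intros s Hs; cbv beta; now rewrite (Hcd s Hs)).
Qed.

Lemma is_vderive_plus (c d : R -> E42) (t : R) (x y : E42) :
  is_vderive c t x -> is_vderive d t y ->
  is_vderive (fun s => plus (c s) (d s)) t (plus x y).
Proof.
  intros (H1 & H2 & H3 & H4) (K1 & K2 & K3 & K4).
  refine (conj _ (conj _ (conj _ _))).
  - apply (is_derive_add _ _ _ _ _ H1 K1).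
  - apply (is_derive_add _ _ _ _ _ H2 K2).
  - apply (is_derive_add _ _ _ _ _ H3 K3).
  - apply (is_derive_add _ _ _ _ _ H4 K4).
Qed.

Lemma is_vderive_scal (a : R -> R) (c : R -> E42) (t a' : R) (x : E42) :
  is_derive a t a' -> is_vderive c t x ->
  is_vderive (fun s => scal (a s) (c s)) t
    (plus (scal a' (c t)) (scal (a t) x)).
Proof.
  intros Ha (H1 & H2 & H3 & H4).
  refine (conj _ (conj _ (conj _ _))).
  - apply (is_derive_times _ _ _ _ _ Ha H1).
  - apply (is_derive_times _ _ _ _ _ Ha H2).
  - apply (is_derive_times _ _ _ _ _ Ha H3).
  - apply (is_derive_times _ _ _ _ _ Ha H4).
Qed.

Lemma is_vderive_const (x : E42) (t : R) : is_vderive (fun _ => x) t zero.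
Proof.
  refine (conj _ (conj _ (conj _ _))); apply is_derive_cst.
Qed.

Lemma is_derive_inner (c d : R -> E42) (t : R) (x y : E42) :
  is_vderive c t x -> is_vderive d t y ->
  is_derive (fun s => inner (c s) (d s)) t (inner x (d t) + inner (c t) y).
Proof.
  intros (H1 & H2 & H3 & H4) (K1 & K2 & K3 & K4). unfold inner.
  derive_to. ring.
Qed.

(** The frame [l, l', n] of the spherical curve completed by the unit vector
    [e] of the axis.  The two types of surfaces differ by a change of sign of
    the metric, recorded by [eps]. *)
Record frame (eps : R) (J : R -> Prop) (l n : R -> E42) (e : E42) : Prop := {
  fr_sign : is_sign eps;
  fr_int : is_open_interval J;
  fr_l : forall v, J v -> is_vderive l v (vderive l v);
  fr_t : forall v, J v -> is_vderive (vderive l) v (vderive (vderive l) v);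
  fr_n : forall v, J v -> is_vderive n v (vderive n v);
  fr_n' : forall v, J v -> is_vderive (vderive n) v (vderive (vderive n) v);
  fr_ll : forall v, J v -> inner (l v) (l v) = - eps;
  fr_tt : forall v, J v -> inner (vderive l v) (vderive l v) = eps;
  fr_nn : forall v, J v -> inner (n v) (n v) = eps;
  fr_ee : inner e e = - eps;
  fr_lt : forall v, J v -> inner (l v) (vderive l v) = 0;
  fr_ln : forall v, J v -> inner (l v) (n v) = 0;
  fr_tn : forall v, J v -> inner (vderive l v) (n v) = 0;
  fr_le : forall v, J v -> inner (l v) e = 0;
  fr_te : forall v, J v -> inner (vderive l v) e = 0;
  fr_ne : forall v, J v -> inner (n v) e = 0;
  fr_complete : forall v x, J v ->
    inner x (l v) = 0 -> inner x (vderive l v) = 0 -> inner x (n v) = 0 ->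
    inner x e = 0 -> x = zero }.

Definition comb (l n : R -> E42) (e : E42) (v a b c d : R) : E42 :=
  plus (plus (scal a (l v)) (scal b (vderive l v)))
       (plus (scal c (n v)) (scal d e)).

Ltac vec_unfold :=
  apply vec_ext; unfold comb, vec, x1, x2, x3, x4 in *; cbn;
  unfold mult; cbn.

Lemma comb_plus l n e v a b c d a' b' c' d' :
  plus (comb l n e v a b c d) (comb l n e v a' b' c' d')
  = comb l n e v (a + a') (b + b') (c + c') (d + d').
Proof. vec_unfold; ring. Qed.

Lemma comb_scal l n e v k a b c d :
  scal k (comb l n e v a b c d) = comb l n e v (k * a) (k * b) (k * c) (k * d).
Proof. vec_unfold; ring. Qed.

Lemma comb_minus l n e v a b c d a' b' c' d' :
  minus (comb l n e v a b c d) (comb l n e v a' b' c' d')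
  = comb l n e v (a - a') (b - b') (c - c') (d - d').
Proof. vec_unfold; ring. Qed.

Lemma inner_comb eps J l n e v a b c d a' b' c' d' :
  frame eps J l n e -> J v ->
  inner (comb l n e v a b c d) (comb l n e v a' b' c' d')
  = eps * (- a * a' + b * b' + c * c' - d * d').
Proof.
  intros F Hv. unfold comb.
  rewrite !inner_plus_r, !inner_scal_r, !inner_plus_l, !inner_scal_l.
  rewrite (inner_comm (vderive l v) (l v)), (inner_comm (n v) (l v)),
    (inner_comm (n v) (vderive l v)), (inner_comm e (l v)),
    (inner_comm e (vderive l v)), (inner_comm e (n v)).
  rewrite (fr_ll _ _ _ _ _ F v Hv), (fr_tt _ _ _ _ _ F v Hv),
    (fr_nn _ _ _ _ _ F v Hv), (fr_ee _ _ _ _ _ F), (fr_lt _ _ _ _ _ F v Hv),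
    (fr_ln _ _ _ _ _ F v Hv), (fr_tn _ _ _ _ _ F v Hv),
    (fr_le _ _ _ _ _ F v Hv), (fr_te _ _ _ _ _ F v Hv),
    (fr_ne _ _ _ _ _ F v Hv). ring.
Qed.

Lemma inner_minus_l (x y z : E42) : inner (minus x y) z = inner x z - inner y z.
Proof.
  destruct x as [[[? ?] ?] ?], y as [[[? ?] ?] ?].
  unfold inner; cbn; ring.
Qed.

Lemma minus_zero_eq (x y : E42) : minus x y = zero -> x = y.
Proof.
  intros H. apply vec_ext; apply Rminus_diag_uniq.
  - exact (f_equal x1 H).
  - exact (f_equal x2 H).
  - exact (f_equal x3 H).
  - exact (f_equal x4 H).
Qed.

Lemma comb_unique eps J l n e v x a b c d :
  frame eps J l n e -> J v ->
  inner x (l v) = - eps * a -> inner x (vderive l v) = eps * b ->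
  inner x (n v) = eps * c -> inner x e = - eps * d ->
  x = comb l n e v a b c d.
Proof.
  intros F Hv H1 H2 H3 H4. apply minus_zero_eq.
  apply (fr_complete _ _ _ _ _ F v); auto; rewrite inner_minus_l;
    [rewrite H1 | rewrite H2 | rewrite H3 | rewrite H4].
  - replace (l v) with (comb l n e v 1 0 0 0) at 1
      by (vec_unfold; ring).
    rewrite (inner_comb eps J); auto; ring.
  - replace (vderive l v) with (comb l n e v 0 1 0 0) at 1
      by (vec_unfold; ring).
    rewrite (inner_comb eps J); auto; ring.
  - replace (n v) with (comb l n e v 0 0 1 0) at 1
      by (vec_unfold; ring).
    rewrite (inner_comb eps J); auto; ring.
  - replace e with (comb l n e v 0 0 0 1) at 2
      by (vec_unfold; ring).
    rewrite (inner_comb eps J); auto; ring.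
Qed.

Lemma derive_inner_constant (J : R -> Prop) (c d : R -> E42) (k v : R)
  (x y : E42) :
  is_open_interval J -> J v -> (forall t, J t -> inner (c t) (d t) = k) ->
  is_vderive c v x -> is_vderive d v y ->
  inner x (d v) + inner (c v) y = 0.
Proof.
  intros HJ Hv Hk Hc Hd. apply (derive_unique (fun s => inner (c s) (d s)) v).
  - now apply is_derive_inner.
  - apply (is_derive_congr J (fun _ => k)); auto.
    + intros t Ht. now rewrite (Hk t Ht).
    + apply is_derive_cst.
Qed.

(** First Frenet equation: the coefficients come from differentiating the
    orthonormality relations. *)
Lemma frenet_t eps J l n e v :
  frame eps J l n e -> J v ->
  vderive (vderive l) v
  = comb l n e v 1 0 (eps * spherical_curvature l n v) 0.
Proof.
  intros F Hv. pose proof (fr_int _ _ _ _ _ F) as HJ.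
  pose proof (fr_t _ _ _ _ _ F v Hv) as Ht.
  pose proof (fr_l _ _ _ _ _ F v Hv) as Hl.
  pose proof (is_sign_square _ (fr_sign _ _ _ _ _ F)) as Hs.
  apply (comb_unique eps J); auto.
  - pose proof (derive_inner_constant J l (vderive l) 0 v _ _ HJ Hv
      (fr_lt _ _ _ _ _ F) Hl Ht) as H.
    rewrite (fr_tt _ _ _ _ _ F v Hv), inner_comm in H. lra.
  - pose proof (derive_inner_constant J _ _ _ v _ _ HJ Hv
      (fr_tt _ _ _ _ _ F) Ht Ht) as H.
    rewrite (inner_comm (vderive l v)) in H. lra.
  - fold (spherical_curvature l n v).
    transitivity (eps ^ 2 * spherical_curvature l n v); [|ring].
    rewrite Hs. ring.
  - pose proof (derive_inner_constant J _ _ _ v _ _ HJ Hv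
      (fr_te _ _ _ _ _ F) Ht (is_vderive_const e v)) as H.
    rewrite (inner_comm _ zero), inner_zero_l in H. lra.
Qed.

Lemma inner_n'_t eps J l n e v :
  frame eps J l n e -> J v ->
  inner (vderive n v) (vderive l v) = - spherical_curvature l n v.
Proof.
  intros F Hv.
  pose proof (derive_inner_constant J _ _ _ v _ _ (fr_int _ _ _ _ _ F) Hv
    (fr_tn _ _ _ _ _ F) (fr_t _ _ _ _ _ F v Hv) (fr_n _ _ _ _ _ F v Hv)) as H.
  rewrite (inner_comm (vderive l v)) in H. unfold spherical_curvature. lra.
Qed.

Lemma frenet_n eps J l n e v :
  frame eps J l n e -> J v ->
  vderive n v = comb l n e v 0 (- eps * spherical_curvature l n v) 0 0.
Proof.
  intros F Hv. pose proof (fr_int _ _ _ _ _ F) as HJ.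
  pose proof (fr_n _ _ _ _ _ F v Hv) as Hn.
  pose proof (fr_l _ _ _ _ _ F v Hv) as Hl.
  pose proof (is_sign_square _ (fr_sign _ _ _ _ _ F)) as Hs.
  apply (comb_unique eps J); auto.
  - pose proof (derive_inner_constant J l n 0 v _ _ HJ Hv
      (fr_ln _ _ _ _ _ F) Hl Hn) as H.
    rewrite (fr_tn _ _ _ _ _ F v Hv), inner_comm in H. lra.
  - rewrite (inner_n'_t eps J l n e v F Hv).
    transitivity (- (eps ^ 2 * spherical_curvature l n v)); [|ring].
    rewrite Hs. ring.
  - pose proof (derive_inner_constant J _ _ _ v _ _ HJ Hv
      (fr_nn _ _ _ _ _ F) Hn Hn) as H.
    rewrite (inner_comm (n v)) in H. lra.
  - pose proof (derive_inner_constant J _ _ _ v _ _ HJ Hv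
      (fr_ne _ _ _ _ _ F) Hn (is_vderive_const e v)) as H.
    rewrite (inner_comm _ zero), inner_zero_l in H. lra.
Qed.

(** Expressed as [- <n', l'>], the curvature only needs two derivatives of
    [l]. *)
Lemma ex_derive_curvature eps J l n e v :
  frame eps J l n e -> J v -> ex_derive (spherical_curvature l n) v.
Proof.
  intros F Hv. eexists.
  apply (is_derive_congr J (fun s => - inner (vderive n s) (vderive l s)));
    [apply (fr_int _ _ _ _ _ F)|exact Hv| |].
  - intros s Hs. rewrite (inner_n'_t eps J l n e s F Hs). ring.
  - apply is_derive_neg. apply is_derive_inner.
    + apply (fr_n' _ _ _ _ _ F v Hv).
    + apply (fr_t _ _ _ _ _ F v Hv).
Qed.

Lemma is_vderive_comb_u l n e v a b c d u a' b' c' d' :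
  is_derive a u a' -> is_derive b u b' -> is_derive c u c' ->
  is_derive d u d' ->
  is_vderive (fun s => comb l n e v (a s) (b s) (c s) (d s)) u
    (comb l n e v a' b' c' d').
Proof.
  intros Ha Hb Hc Hd.
  pose proof (is_vderive_plus _ _ _ _ _
    (is_vderive_plus _ _ _ _ _
       (is_vderive_scal a (fun _ => l v) u _ _ Ha (is_vderive_const _ _))
       (is_vderive_scal b (fun _ => vderive l v) u _ _ Hb
          (is_vderive_const _ _)))
    (is_vderive_plus _ _ _ _ _
       (is_vderive_scal c (fun _ => n v) u _ _ Hc (is_vderive_const _ _))
       (is_vderive_scal d (fun _ => e) u _ _ Hd (is_vderive_const _ _)))) as H.
  match type of H with is_vderive _ _ ?x =>
    replace (comb l n e v a' b' c' d') with x end.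
  - exact H.
  - vec_unfold; ring.
Qed.

Lemma is_vderive_comb_v eps J l n e a b c d v a' b' c' d' :
  frame eps J l n e -> J v ->
  is_derive a v a' -> is_derive b v b' -> is_derive c v c' ->
  is_derive d v d' ->
  is_vderive (fun s => comb l n e s (a s) (b s) (c s) (d s)) v
    (comb l n e v (a' + b v)
      (b' + a v - eps * spherical_curvature l n v * c v)
      (c' + eps * spherical_curvature l n v * b v) d').
Proof.
  intros F Hv Ha Hb Hc Hd.
  pose proof (is_vderive_plus _ _ _ _ _
    (is_vderive_plus _ _ _ _ _
       (is_vderive_scal a l v _ _ Ha (fr_l _ _ _ _ _ F v Hv))
       (is_vderive_scal b (vderive l) v _ _ Hb (fr_t _ _ _ _ _ F v Hv)))
    (is_vderive_plus _ _ _ _ _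
       (is_vderive_scal c n v _ _ Hc (fr_n _ _ _ _ _ F v Hv))
       (is_vderive_scal d (fun _ => e) v _ _ Hd (is_vderive_const _ _)))) as H.
  cbv beta in H.
  rewrite (frenet_t eps J l n e v F Hv), (frenet_n eps J l n e v F Hv) in H.
  match type of H with is_vderive _ _ ?x =>
    replace (comb l n e v (a' + b v)
      (b' + a v - eps * spherical_curvature l n v * c v)
      (c' + eps * spherical_curvature l n v * b v) d') with x end.
  - exact H.
  - generalize (spherical_curvature l n v). intros k. vec_unfold; ring.
Qed.

(** * Geometry of a meridian surface *)

Record meridian_surface (eps : R) (I J : R -> Prop) (f g : R -> R)
  (l n : R -> E42) (e : E42) (z : R -> R -> E42) : Prop := {
  ms_mer : meridian I f g;
  ms_frame : frame eps J l n e;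
  ms_z : forall u v, z u v = comb l n e v (f u) 0 0 (g u) }.

Lemma surface_du eps I J f g l n e z u v :
  meridian_surface eps I J f g l n e z -> I u ->
  du z u v = comb l n e v (Derive f u) 0 0 (Derive g u).
Proof.
  intros S Hu. pose proof (ms_mer _ _ _ _ _ _ _ _ _ S) as M.
  destruct (smooth_derivatives I f u (mer_f _ _ _ M) Hu) as (F1 & _).
  destruct (smooth_derivatives I g u (mer_g _ _ _ M) Hu) as (G1 & _).
  apply vderive_eq.
  apply (is_vderive_congr I (fun s => comb l n e v (f s) 0 0 (g s)));
    [apply (mer_int _ _ _ M)|exact Hu| |].
  - intros s _. symmetry. apply (ms_z _ _ _ _ _ _ _ _ _ S).
  - apply is_vderive_comb_u; auto using is_derive_cst.
Qed.

Lemma surface_dv eps I J f g l n e z u v :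
  meridian_surface eps I J f g l n e z -> J v ->
  dv z u v = comb l n e v 0 (f u) 0 0.
Proof.
  intros S Hv. pose proof (ms_frame _ _ _ _ _ _ _ _ _ S) as F.
  apply vderive_eq.
  apply (is_vderive_congr J (fun s => comb l n e s (f u) 0 0 (g u)));
    [apply (fr_int _ _ _ _ _ F)|exact Hv| |].
  - intros s _. symmetry. apply (ms_z _ _ _ _ _ _ _ _ _ S).
  - pose proof (is_vderive_comb_v eps J l n e (fun _ => f u) (fun _ => 0)
      (fun _ => 0) (fun _ => g u) v 0 0 0 0 F Hv (is_derive_cst _ _)
      (is_derive_cst _ _) (is_derive_cst _ _) (is_derive_cst _ _)) as H.
    cbv beta in H.
    replace (0 + 0) with 0 in H by ring.
    replace (0 + f u - _) with (f u) in H by ring.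
    replace (0 + eps * _ * 0) with 0 in H by ring. exact H.
Qed.

Lemma surface_duu eps I J f g l n e z u v :
  meridian_surface eps I J f g l n e z -> I u ->
  du (du z) u v = comb l n e v (Derive (Derive f) u) 0 0 (Derive (Derive g) u).
Proof.
  intros S Hu. pose proof (ms_mer _ _ _ _ _ _ _ _ _ S) as M.
  destruct (smooth_derivatives I f u (mer_f _ _ _ M) Hu) as (_ & F2 & _).
  destruct (smooth_derivatives I g u (mer_g _ _ _ M) Hu) as (_ & G2 & _).
  apply vderive_eq.
  apply (is_vderive_congr I
      (fun s => comb l n e v (Derive f s) 0 0 (Derive g s)));
    [apply (mer_int _ _ _ M)|exact Hu| |].
  - intros s Hs. symmetry. now apply (surface_du eps I J f g l n e z).
  - apply is_vderive_comb_u; auto using is_derive_cst.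
Qed.

Lemma surface_duv eps I J f g l n e z u v :
  meridian_surface eps I J f g l n e z -> I u -> J v ->
  du (dv z) u v = comb l n e v 0 (Derive f u) 0 0.
Proof.
  intros S Hu Hv. pose proof (ms_mer _ _ _ _ _ _ _ _ _ S) as M.
  destruct (smooth_derivatives I f u (mer_f _ _ _ M) Hu) as (F1 & _).
  apply vderive_eq.
  apply (is_vderive_congr I (fun s => comb l n e v 0 (f s) 0 0));
    [apply (mer_int _ _ _ M)|exact Hu| |].
  - intros s Hs. symmetry. now apply (surface_dv eps I J f g l n e z).
  - apply is_vderive_comb_u; auto using is_derive_cst.
Qed.

Lemma surface_dvv eps I J f g l n e z u v :
  meridian_surface eps I J f g l n e z -> J v ->
  dv (dv z) u v
  = comb l n e v (f u) 0 (eps * spherical_curvature l n v * f u) 0.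
Proof.
  intros S Hv. pose proof (ms_frame _ _ _ _ _ _ _ _ _ S) as F.
  apply vderive_eq.
  apply (is_vderive_congr J (fun s => comb l n e s 0 (f u) 0 0));
    [apply (fr_int _ _ _ _ _ F)|exact Hv| |].
  - intros s Hs. symmetry. now apply (surface_dv eps I J f g l n e z).
  - pose proof (is_vderive_comb_v eps J l n e (fun _ => 0) (fun _ => f u)
      (fun _ => 0) (fun _ => 0) v 0 0 0 0 F Hv (is_derive_cst _ _)
      (is_derive_cst _ _) (is_derive_cst _ _) (is_derive_cst _ _)) as H.
    cbv beta in H.
    replace (0 + f u) with (f u) in H by ring.
    replace (0 + 0 - _) with 0 in H by ring.
    replace (0 + eps * spherical_curvature l n v * f u)
      with (eps * spherical_curvature l n v * f u) in H by ring. exact H.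
Qed.

(** The normal bundle has the frame [n], [- g' l + f' e]; [alpha] and [beta]
    are the coordinates in it. *)
Definition normal_vector (f g : R -> R) (l n : R -> E42) (e : E42)
  (u v alpha beta : R) : E42 :=
  comb l n e v (- Derive g u * beta) 0 alpha (Derive f u * beta).

Lemma surface_metric eps I J f g l n e z u v :
  meridian_surface eps I J f g l n e z -> I u -> J v ->
  fffE z u v = - eps /\ fffF z u v = 0 /\ fffG z u v = eps * f u ^ 2 /\
  fffW z u v = - f u ^ 2.
Proof.
  intros S Hu Hv. pose proof (ms_frame _ _ _ _ _ _ _ _ _ S) as F.
  pose proof (mer_arc _ _ _ (ms_mer _ _ _ _ _ _ _ _ _ S) u Hu) as Ha.
  pose proof (is_sign_square _ (fr_sign _ _ _ _ _ F)) as Hs.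
  assert (HE : fffE z u v = - eps).
  { unfold fffE. rewrite (surface_du eps I J f g l n e z u v S Hu).
    rewrite (inner_comb eps J); auto.
    transitivity (- eps * (Derive f u ^ 2 + Derive g u ^ 2)); [ring|].
    rewrite Ha. ring. }
  assert (HF : fffF z u v = 0).
  { unfold fffF. rewrite (surface_du eps I J f g l n e z u v S Hu).
    rewrite (surface_dv eps I J f g l n e z u v S Hv).
    rewrite (inner_comb eps J); auto. ring. }
  assert (HG : fffG z u v = eps * f u ^ 2).
  { unfold fffG. rewrite (surface_dv eps I J f g l n e z u v S Hv).
    rewrite (inner_comb eps J); auto. ring. }
  repeat split; auto.
  unfold fffW. rewrite HE, HF, HG.
  transitivity (- eps ^ 2 * f u ^ 2); [ring|]. rewrite Hs. ring.
Qed.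

(** [- g' l + f' e] is the rotation by a quarter turn of the unit tangent
    [f' l + g' e] of the meridian, so the normal coordinates of a vector are its
    [n] coordinate and the determinant [d f' - a g']. *)
Lemma normal_part_comb eps I J f g l n e z u v a b c d :
  meridian_surface eps I J f g l n e z -> I u -> J v ->
  normal_part z u v (comb l n e v a b c d)
  = normal_vector f g l n e u v c (d * Derive f u - a * Derive g u).
Proof.
  intros S Hu Hv. pose proof (ms_frame _ _ _ _ _ _ _ _ _ S) as F.
  pose proof (mer_arc _ _ _ (ms_mer _ _ _ _ _ _ _ _ _ S) u Hu) as Ha.
  pose proof (mer_f0 _ _ _ (ms_mer _ _ _ _ _ _ _ _ _ S) u Hu) as Hf.
  pose proof (is_sign_square _ (fr_sign _ _ _ _ _ F)) as Hs.
  destruct (surface_metric eps I J f g l n e z u v S Hu Hv)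
    as (HE & HF & HG & HW).
  unfold normal_part. rewrite HE, HF, HG, HW.
  rewrite (surface_du eps I J f g l n e z u v S Hu).
  rewrite (surface_dv eps I J f g l n e z u v S Hv).
  rewrite !(inner_comb eps J); auto.
  replace ((eps * f u ^ 2 * (eps * (- a * Derive f u + b * 0 + c * 0
       - d * Derive g u)) - 0 * (eps * (- a * 0 + b * f u + c * 0 - d * 0)))
      / - f u ^ 2) with (a * Derive f u + d * Derive g u).
  2:{ transitivity (eps ^ 2 * (a * Derive f u + d * Derive g u));
        [rewrite Hs; ring | field; auto]. }
  replace ((- eps * (eps * (- a * 0 + b * f u + c * 0 - d * 0))
      - 0 * (eps * (- a * Derive f u + b * 0 + c * 0 - d * Derive g u)))
      / - f u ^ 2) with (b / f u).
  2:{ transitivity (eps ^ 2 * (b / f u)); [rewrite Hs; ring | field; auto]. }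
  rewrite !comb_scal, comb_plus, comb_minus. unfold normal_vector.
  f_equal.
  - transitivity (a * (1 - Derive f u ^ 2) - d * Derive f u * Derive g u);
      [ring|]. rewrite <- Ha. ring.
  - field; auto.
  - ring.
  - transitivity (d * (1 - Derive g u ^ 2) - a * Derive f u * Derive g u);
      [ring|]. rewrite <- Ha. ring.
Qed.

Lemma inner_normal_vector eps I J f g l n e z u v a b a' b' :
  meridian_surface eps I J f g l n e z -> I u -> J v ->
  inner (normal_vector f g l n e u v a b) (normal_vector f g l n e u v a' b')
  = eps * (a * a' - b * b').
Proof.
  intros S Hu Hv. unfold normal_vector.
  rewrite (inner_comb eps J); auto; [|apply (ms_frame _ _ _ _ _ _ _ _ _ S)].
  pose proof (mer_arc _ _ _ (ms_mer _ _ _ _ _ _ _ _ _ S) u Hu) as Ha.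
  transitivity (eps * (a * a' - (Derive f u ^ 2 + Derive g u ^ 2) * (b * b')));
    [ring|]. rewrite Ha. ring.
Qed.

Lemma normal_vector_zero eps I J f g l n e z u v a b :
  meridian_surface eps I J f g l n e z -> I u -> J v ->
  (normal_vector f g l n e u v a b = zero <-> a = 0 /\ b = 0).
Proof.
  intros S Hu Hv.
  pose proof (sign_nonzero _ (fr_sign _ _ _ _ _
    (ms_frame _ _ _ _ _ _ _ _ _ S))) as Hs.
  split.
  - intros H. split; apply (Rmult_eq_reg_l eps); auto.
    + pose proof (inner_normal_vector eps I J f g l n e z u v a b 1 0 S Hu Hv)
        as H1. rewrite H, inner_zero_l in H1. lra.
    + pose proof (inner_normal_vector eps I J f g l n e z u v a b 0 1 S Hu Hv)
        as H1. rewrite H, inner_zero_l in H1. lra.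
  - intros [-> ->]. unfold normal_vector. vec_unfold; ring.
Qed.

Lemma normal_vector_scal f g l n e u v k a b :
  scal k (normal_vector f g l n e u v a b)
  = normal_vector f g l n e u v (k * a) (k * b).
Proof.
  unfold normal_vector. rewrite comb_scal. f_equal; ring.
Qed.

Lemma mean_curvature_formula eps I J f g l n e z u v :
  meridian_surface eps I J f g l n e z -> I u -> J v ->
  mean_curvature z u v
  = normal_vector f g l n e u v (spherical_curvature l n v / (2 * f u))
      (- eps * bend f g u / (2 * f u)).
Proof.
  intros S Hu Hv. pose proof (ms_frame _ _ _ _ _ _ _ _ _ S) as F.
  pose proof (mer_f0 _ _ _ (ms_mer _ _ _ _ _ _ _ _ _ S) u Hu) as Hf.
  pose proof (is_sign_square _ (fr_sign _ _ _ _ _ F)) as Hs.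
  destruct (surface_metric eps I J f g l n e z u v S Hu Hv)
    as (HE & HF & HG & HW).
  unfold mean_curvature, h_uu, h_uv, h_vv.
  rewrite (surface_duu eps I J f g l n e z u v S Hu).
  rewrite (surface_duv eps I J f g l n e z u v S Hu Hv).
  rewrite (surface_dvv eps I J f g l n e z u v S Hv).
  rewrite !(normal_part_comb eps I J f g l n e z u v); auto.
  rewrite HE, HF, HG, HW, !normal_vector_scal.
  unfold normal_vector. rewrite !comb_plus, comb_scal.
  set (k := spherical_curvature l n v).
  assert (Hk : 1 / 2 * (eps * f u ^ 2 / - f u ^ 2 * 0 + -2 * 0 / - f u ^ 2 * 0
      + - eps / - f u ^ 2 * (eps * k * f u)) = k / (2 * f u)).
  { transitivity (eps ^ 2 * (k / (2 * f u))); [field; auto|rewrite Hs; ring]. }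
  unfold bend. f_equal; [| |exact Hk|]; field; auto.
Qed.

(** The derivatives of [n] and of [- g' l + f' e] are tangent to the surface,
    so the normal connection only differentiates the coordinates. *)
Lemma normal_connection eps I J f g l n e z xi (a b : R -> R -> R)
    (u v au bu av bv : R) :
  meridian_surface eps I J f g l n e z -> I u -> J v ->
  (forall s t, I s -> J t ->
     xi s t = normal_vector f g l n e s t (a s t) (b s t)) ->
  is_derive (fun s => a s v) u au -> is_derive (fun s => b s v) u bu ->
  is_derive (a u) v av -> is_derive (b u) v bv ->
  D_u z xi u v = normal_vector f g l n e u v au bu /\
  D_v z xi u v = normal_vector f g l n e u v av bv.
Proof.
  intros S Hu Hv Hxi Hau Hbu Hav Hbv.
  pose proof (ms_frame _ _ _ _ _ _ _ _ _ S) as F.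
  pose proof (ms_mer _ _ _ _ _ _ _ _ _ S) as M.
  pose proof (mer_arc _ _ _ M u Hu) as Ha.
  pose proof (meridian_acceleration I f g u M Hu) as Hc.
  destruct (smooth_derivatives I f u (mer_f _ _ _ M) Hu) as (_ & F2 & _).
  destruct (smooth_derivatives I g u (mer_g _ _ _ M) Hu) as (_ & G2 & _).
  split.
  - unfold D_u, du at 1.
    rewrite (vderive_eq (fun s => xi s v) u
      (comb l n e v
         (- Derive (Derive g) u * b u v + - Derive g u * bu) 0 au
         (Derive (Derive f) u * b u v + Derive f u * bu))).
    + rewrite (normal_part_comb eps I J f g l n e z u v); auto. f_equal.
      transitivity
        (b u v * (Derive f u * Derive (Derive f) u
                  + Derive g u * Derive (Derive g) u)
         + bu * (Derive f u ^ 2 + Derive g u ^ 2)); [ring|].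
      rewrite Ha, Hc. ring.
    + apply (is_vderive_congr I (fun s => comb l n e v
         (- Derive g s * b s v) 0 (a s v) (Derive f s * b s v)));
        [apply (mer_int _ _ _ M)|exact Hu| |].
      * intros s Hs. now rewrite (Hxi s v Hs Hv).
      * apply is_vderive_comb_u; [|apply is_derive_cst|exact Hau|];
          derive_to; ring.
  - unfold D_v, dv at 1.
    rewrite (vderive_eq (fun s => xi u s) v
      (comb l n e v
         (0 * b u v + - Derive g u * bv + 0)
         (0 + - Derive g u * b u v - eps * spherical_curvature l n v * a u v)
         (av + eps * spherical_curvature l n v * 0)
         (0 * b u v + Derive f u * bv))).
    + rewrite (normal_part_comb eps I J f g l n e z u v); auto. f_equal.
      * ring.
      * transitivity (bv * (Derive f u ^ 2 + Derive g u ^ 2)); [ring|].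
        rewrite Ha. ring.
    + apply (is_vderive_congr J (fun s => comb l n e s
         (- Derive g u * b u s) 0 (a u s) (Derive f u * b u s)));
        [apply (fr_int _ _ _ _ _ F)|exact Hv| |].
      * intros s Hs. now rewrite (Hxi u s Hu Hs).
      * apply (is_vderive_comb_v eps J l n e (fun s => - Derive g u * b u s)
          (fun _ => 0) (a u) (fun s => Derive f u * b u s) v); auto.
        -- apply (is_derive_times (fun _ => - Derive g u) (b u)); auto.
           apply is_derive_cst.
        -- apply is_derive_cst.
        -- apply (is_derive_times (fun _ => Derive f u) (b u)); auto.
           apply is_derive_cst.
Qed.

Lemma parallel_of_constant eps I J f g l n e z xi a b :
  meridian_surface eps I J f g l n e z ->
  (forall s t, I s -> J t -> xi s t = normal_vector f g l n e s t a b) ->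
  parallel_normal_field I J z xi.
Proof.
  intros S Hxi u v Hu Hv.
  destruct (normal_connection eps I J f g l n e z xi (fun _ _ => a)
    (fun _ _ => b) u v 0 0 0 0 S Hu Hv Hxi) as [-> ->];
    try apply is_derive_cst.
  pose proof (proj2 (normal_vector_zero eps I J f g l n e z u v 0 0 S Hu Hv)).
  auto.
Qed.

(** Normalizing [(a, b)] does not change its direction, so if the normalized
    pair is stationary at [x], the ratio of [a] and [b] is stationary too. *)
Lemma normalized_derivatives (a b : R -> R) (x a' b' : R) :
  is_derive a x a' -> is_derive b x b' -> a x ^ 2 - b x ^ 2 <> 0 ->
  exists d1 d2,
    is_derive (fun s => a s / sqrt (Rabs (a s ^ 2 - b s ^ 2))) x d1 /\
    is_derive (fun s => b s / sqrt (Rabs (a s ^ 2 - b s ^ 2))) x d2 /\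
    (d1 = 0 -> d2 = 0 -> a x * b' = b x * a').
Proof.
  intros Ha Hb H0.
  assert (Hd : is_derive (fun s => a s ^ 2 - b s ^ 2) x
    (2 * a x * a' - 2 * b x * b')) by derive_rules.
  pose proof (is_derive_Rabs _ x _ Hd H0) as Hr.
  pose proof (Rabs_pos_lt _ H0) as Hp.
  pose proof (is_derive_sqrt _ x _ Hr Hp) as Hq.
  pose proof (sqrt_lt_R0 _ Hp) as Hn. cbv beta in Hq.
  set (nu := fun s => sqrt (Rabs (a s ^ 2 - b s ^ 2))) in *.
  assert (Hnx : nu x <> 0) by (unfold nu; lra).
  match type of Hq with is_derive _ _ ?d =>
    change (is_derive nu x d) in Hq; set (nu' := d) in Hq end.
  exists ((a' * nu x - a x * nu') / nu x ^ 2),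
         ((b' * nu x - b x * nu') / nu x ^ 2).
  split; [|split].
  - change (is_derive (fun s => a s / nu s) x
      ((a' * nu x - a x * nu') / nu x ^ 2)). now apply is_derive_quot.
  - change (is_derive (fun s => b s / nu s) x
      ((b' * nu x - b x * nu') / nu x ^ 2)). now apply is_derive_quot.
  - intros H1 H2.
    assert (H3 : a' * nu x - a x * nu' = 0).
    { transitivity ((a' * nu x - a x * nu') / nu x ^ 2 * nu x ^ 2);
        [field; auto|rewrite H1; ring]. }
    assert (H4 : b' * nu x - b x * nu' = 0).
    { transitivity ((b' * nu x - b x * nu') / nu x ^ 2 * nu x ^ 2);
        [field; auto|rewrite H2; ring]. }
    apply (Rmult_eq_reg_r (nu x)); auto.
    transitivity (a x * (b' * nu x - b x * nu') + a x * b x * nu'); [ring|].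
    transitivity (b x * (a' * nu x - a x * nu') + a x * b x * nu');
      [rewrite H3, H4; ring|ring].
Qed.

(** Identifies a unit field in the direction of [H] with the explicit
    normalization of [H], which can be differentiated. *)
Lemma unit_multiple (eps lam a b : R) :
  is_sign eps -> 0 < lam ->
  (eps * ((lam * a) ^ 2 - (lam * b) ^ 2) = 1 \/
   eps * ((lam * a) ^ 2 - (lam * b) ^ 2) = -1) ->
  lam = / sqrt (Rabs (a ^ 2 - b ^ 2)).
Proof.
  intros He Hl H.
  assert (H1 : Rabs (lam ^ 2 * (a ^ 2 - b ^ 2)) = 1).
  { replace (lam ^ 2 * (a ^ 2 - b ^ 2)) with ((lam * a) ^ 2 - (lam * b) ^ 2)
      by ring.
    set (y := (lam * a) ^ 2 - (lam * b) ^ 2) in *.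
    assert (Hy : y = 1 \/ y = -1) by (destruct He as [->| ->]; lra).
    destruct Hy as [->| ->]; [apply Rabs_R1|].
    rewrite Rabs_left; lra. }
  rewrite Rabs_mult, (Rabs_right (lam ^ 2)) in H1
    by (apply Rle_ge, pow2_ge_0).
  assert (H2 : lam * sqrt (Rabs (a ^ 2 - b ^ 2)) = 1).
  { rewrite <- sqrt_1, <- H1, sqrt_mult, sqrt_pow2;
      auto using Rabs_pos; try lra.
    apply pow2_ge_0. }
  assert (sqrt (Rabs (a ^ 2 - b ^ 2)) <> 0)
    by (intros H0; rewrite H0 in H2; lra).
  apply (Rmult_eq_reg_r (sqrt (Rabs (a ^ 2 - b ^ 2)))); auto.
  rewrite H2. field; auto.
Qed.

(** The condition that the coordinates [kappa / (2 f)] and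
    [- eps bend / (2 f)] of [H] have a constant ratio; [r ^ 2 <> 1] says that
    [H] is not lightlike. *)
Definition proportional_bend (I J : R -> Prop) (f g kappa : R -> R) (r : R)
  : Prop :=
  r ^ 2 <> 1 /\ forall u v, I u -> J v -> bend f g u = r * kappa v.

(** The ratio [bend(u) / kappa(v)] is stationary in each variable, that is
    [bend' = 0] and [bend kappa' = 0]. *)
Lemma proportional_of_parallel_normalized eps I J f g l n e z :
  meridian_surface eps I J f g l n e z ->
  (forall v, J v -> spherical_curvature l n v <> 0) ->
  parallel_normalized_mean_curvature I J z ->
  exists r, proportional_bend I J f g (spherical_curvature l n) r.
Proof.
  intros S Hk0 (HH & b & Hb & Hpar).
  set (kappa := spherical_curvature l n) in *.
  pose proof (ms_frame _ _ _ _ _ _ _ _ _ S) as F.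
  pose proof (fr_sign _ _ _ _ _ F) as Heps.
  pose proof (is_sign_square _ Heps) as Hs.
  pose proof (sign_nonzero _ Heps) as Hs0.
  pose proof (ms_mer _ _ _ _ _ _ _ _ _ S) as M.
  pose proof (mer_int _ _ _ M) as HI. pose proof (fr_int _ _ _ _ _ F) as HJ.
  set (A := fun u v : R => kappa v / (2 * f u)).
  set (B := fun u v : R => - eps * bend f g u / (2 * f u)).
  set (N := fun u v : R => sqrt (Rabs (A u v ^ 2 - B u v ^ 2))).
  assert (HAB : forall u v, I u -> J v -> A u v ^ 2 - B u v ^ 2 <> 0).
  { intros u v Hu Hv H0. destruct (HH u v Hu Hv) as [_ H1]. apply H1.
    rewrite (mean_curvature_formula eps I J f g l n e z u v S Hu Hv).
    rewrite (inner_normal_vector eps I J f g l n e z); auto.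
    transitivity (eps * (A u v ^ 2 - B u v ^ 2)); [unfold A, B, kappa; ring|].
    rewrite H0. ring. }
  assert (Hbn : forall u v, I u -> J v ->
    b u v = normal_vector f g l n e u v (A u v / N u v) (B u v / N u v)).
  { intros u v Hu Hv. destruct (Hb u v Hu Hv) as (Hunit & lam & Hlam & Heq).
    rewrite (mean_curvature_formula eps I J f g l n e z u v S Hu Hv) in Heq.
    fold kappa in Heq. fold (A u v) (B u v) in Heq.
    rewrite normal_vector_scal in Heq.
    unfold unit_vector in Hunit. rewrite Heq in Hunit.
    rewrite (inner_normal_vector eps I J f g l n e z) in Hunit; auto.
    replace (lam * A u v * (lam * A u v) - lam * B u v * (lam * B u v))
      with ((lam * A u v) ^ 2 - (lam * B u v) ^ 2) in Hunit by ring.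
    pose proof (unit_multiple eps lam _ _ Heps Hlam Hunit) as Hl.
    rewrite Heq, Hl. fold (N u v). f_equal; unfold Rdiv; ring. }
  assert (Hder : forall u v, I u -> J v ->
    Derive (bend f g) u = 0 /\ bend f g u * Derive kappa v = 0).
  { intros u v Hu Hv.
    pose proof (mer_f0 _ _ _ M u Hu) as Hf0.
    assert (H2f : 2 * f u <> 0) by lra.
    destruct (smooth_derivatives I f u (mer_f _ _ _ M) Hu) as (F1 & _).
    assert (M1 : is_derive (bend f g) u (Derive (bend f g) u)).
    { apply Derive_correct. eexists. apply (is_derive_bend I f g u M Hu). }
    assert (K1 : is_derive kappa v (Derive kappa v)).
    { apply Derive_correct. apply (ex_derive_curvature eps J l n e v F Hv). }
    assert (Au : is_derive (fun s => A s v) u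
      ((0 * (2 * f u) - kappa v * (0 * f u + 2 * Derive f u))
        / (2 * f u) ^ 2)) by (unfold A; derive_to; reflexivity).
    assert (Bu : is_derive (fun s => B s v) u
      (((0 * bend f g u + - eps * Derive (bend f g) u) * (2 * f u)
        - - eps * bend f g u * (0 * f u + 2 * Derive f u))
        / (2 * f u) ^ 2)).
    { unfold B. apply (is_derive_quot (fun s => - eps * bend f g s)
        (fun s => 2 * f s)); [|derive_rules|exact H2f].
      apply (is_derive_times (fun _ => - eps) (bend f g)); auto.
      apply is_derive_cst. }
    assert (Av : is_derive (A u) v
      ((Derive kappa v * (2 * f u) - kappa v * 0) / (2 * f u) ^ 2)).
    { apply (is_derive_quot kappa (fun _ => 2 * f u)); auto.
      apply is_derive_cst. }
    assert (Bv : is_derive (B u) v 0) by apply is_derive_cst.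
    destruct (normalized_derivatives (fun s => A s v) (fun s => B s v) u _ _
      Au Bu (HAB u v Hu Hv)) as (au & bu & Hau & Hbu & Hu').
    destruct (normalized_derivatives (A u) (B u) v _ _
      Av Bv (HAB u v Hu Hv)) as (av & bv & Hav & Hbv & Hv').
    destruct (normal_connection eps I J f g l n e z b
      (fun s t => A s t / N s t) (fun s t => B s t / N s t) u v au bu av bv
      S Hu Hv Hbn Hau Hbu Hav Hbv) as [HDu HDv].
    destruct (Hpar u v Hu Hv) as [Zu Zv]. rewrite HDu in Zu. rewrite HDv in Zv.
    apply (normal_vector_zero eps I J f g l n e z u v _ _ S Hu Hv) in Zu, Zv.
    specialize (Hu' (proj1 Zu) (proj2 Zu)).
    specialize (Hv' (proj1 Zv) (proj2 Zv)).
    pose proof (Hk0 v Hv) as Hkv. fold kappa in Hkv.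
    split.
    - apply (Rmult_eq_reg_l (- eps * kappa v / (4 * f u ^ 2))).
      2:{ apply Rmult_integral_contrapositive_currified.
          - apply Rmult_integral_contrapositive_currified; lra.
          - apply Rinv_neq_0_compat.
            apply Rmult_integral_contrapositive_currified; [lra|]. now apply pow_nonzero. }
      match type of Hu' with ?x = ?y => transitivity (x - y) end.
      + unfold A, B. field; auto.
      + rewrite Hu'. ring.
    - match type of Hv' with ?x = ?y =>
        transitivity ((y - x) * (- eps * (4 * f u ^ 2))) end.
      + transitivity (eps ^ 2 * (bend f g u * Derive kappa v)).
        * rewrite Hs. ring.
        * unfold A, B. field; auto.
      + rewrite Hv'. ring. }
  pose proof HI as (_ & (u0 & Hu0) & _). pose proof HJ as (_ & (v0 & Hv0) & _).
  assert (Hbend : forall u, I u -> bend f g u = bend f g u0).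
  { intros u Hu. apply (constant_on_interval I (bend f g)); auto.
    intros t Ht. destruct (Hder t v0 Ht Hv0) as [<- _].
    apply Derive_correct. eexists. apply (is_derive_bend I f g t M Ht). }
  exists (bend f g u0 / kappa v0). split.
  - intros H1. apply (HAB u0 v0 Hu0 Hv0).
    assert (H2 : bend f g u0 ^ 2 = kappa v0 ^ 2).
    { transitivity ((bend f g u0 / kappa v0) ^ 2 * kappa v0 ^ 2).
      - field. apply (Hk0 v0 Hv0).
      - rewrite H1. ring. }
    unfold A, B.
    transitivity ((kappa v0 ^ 2 - eps ^ 2 * bend f g u0 ^ 2) / (4 * f u0 ^ 2)).
    + field. apply (mer_f0 _ _ _ M u0 Hu0).
    + rewrite Hs, H2. unfold Rdiv. ring.
  - intros u v Hu Hv. rewrite (Hbend u Hu).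
    destruct (Req_dec (bend f g u0) 0) as [Hz|Hz].
    + rewrite Hz. unfold Rdiv. ring.
    + replace (kappa v) with (kappa v0).
      { field. apply (Hk0 v0 Hv0). }
      apply (constant_on_interval J kappa); auto.
      intros t Ht. destruct (Hder u0 t Hu0 Ht) as [_ H1].
      destruct (Rmult_integral _ _ H1) as [H2|H2]; [contradiction|].
      rewrite <- H2. apply Derive_correct.
      apply (ex_derive_curvature eps J l n e t F Ht).
Qed.

(** The normalized field has constant coordinates, because the sign of
    [f kappa], which is also that of the first coordinate of [H], does not
    change. *)
Lemma parallel_normalized_of_proportional eps I J f g l n e z r :
  meridian_surface eps I J f g l n e z ->
  (forall v, J v -> spherical_curvature l n v <> 0) ->
  proportional_bend I J f g (spherical_curvature l n) r ->
  parallel_normalized_mean_curvature I J z.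
Proof.
  intros S Hk0 [Hr Hprop].
  set (kappa := spherical_curvature l n) in *.
  pose proof (ms_frame _ _ _ _ _ _ _ _ _ S) as F.
  pose proof (fr_sign _ _ _ _ _ F) as Heps.
  pose proof (is_sign_square _ Heps) as Hs.
  pose proof (sign_nonzero _ Heps) as Hs0.
  pose proof (ms_mer _ _ _ _ _ _ _ _ _ S) as M.
  pose proof (mer_int _ _ _ M) as HI. pose proof (fr_int _ _ _ _ _ F) as HJ.
  destruct (sign_on_interval I f HI) as (s1 & Hs1 & Hf1).
  { intros u Hu. exact (mer_f _ _ _ M 1%nat u Hu). }
  { apply (mer_f0 _ _ _ M). }
  destruct (sign_on_interval J kappa HJ) as (s2 & Hs2 & Hk2).
  { intros v Hv. apply (ex_derive_curvature eps J l n e v F Hv). }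
  { exact Hk0. }
  assert (HH : forall u v, I u -> J v -> mean_curvature z u v
    = normal_vector f g l n e u v (kappa v / (2 * f u))
        (- eps * r * (kappa v / (2 * f u)))).
  { intros u v Hu Hv.
    rewrite (mean_curvature_formula eps I J f g l n e z u v S Hu Hv).
    fold kappa. f_equal. rewrite (Hprop u v Hu Hv). fold kappa.
    unfold Rdiv. ring. }
  assert (HHH : forall u v, I u -> J v ->
    inner (mean_curvature z u v) (mean_curvature z u v) <> 0).
  { intros u v Hu Hv. rewrite (HH u v Hu Hv).
    rewrite (inner_normal_vector eps I J f g l n e z); auto.
    pose proof (Hk0 v Hv) as Hkv. fold kappa in Hkv.
    pose proof (mer_f0 _ _ _ M u Hu) as Hf0.
    replace (eps * _) with
      (eps * ((1 - eps ^ 2 * r ^ 2) * (kappa v / (2 * f u)) ^ 2)) by ring.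
    assert (Ha : kappa v / (2 * f u) <> 0).
    { apply Rmult_integral_contrapositive_currified; auto.
      apply Rinv_neq_0_compat. lra. }
    rewrite Hs. apply Rmult_integral_contrapositive_currified; auto.
    apply Rmult_integral_contrapositive_currified; [lra|].
    now apply pow_nonzero. }
  split.
  - intros u v Hu Hv. split; [|auto]. intros H0. apply (HHH u v Hu Hv).
    rewrite H0. apply inner_zero_l.
  - assert (Hr1 : 1 - r ^ 2 <> 0) by lra.
    pose proof (Rabs_pos_lt _ Hr1) as Hra.
    pose proof (sqrt_lt_R0 _ Hra) as Hnu.
    pose proof (sqrt_sqrt _ (Rlt_le _ _ Hra)) as Hnu2.
    set (nu := sqrt (Rabs (1 - r ^ 2))) in *.
    exists (fun u v => normal_vector f g l n e u v (s1 * s2 / nu)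
              (- eps * r * (s1 * s2 / nu))).
    split.
    2:{ apply (parallel_of_constant eps I J f g l n e z _ (s1 * s2 / nu)
          (- eps * r * (s1 * s2 / nu)) S). auto. }
    intros u v Hu Hv. split.
    + unfold unit_vector.
      rewrite (inner_normal_vector eps I J f g l n e z); auto.
      replace (eps * _) with
        (eps * (1 - eps ^ 2 * r ^ 2) * (s1 ^ 2 * s2 ^ 2) / (nu * nu))
        by (field; lra).
      rewrite Hs, (is_sign_square _ Hs1), (is_sign_square _ Hs2), Hnu2.
      replace (1 - 1 * r ^ 2) with (1 - r ^ 2) by ring.
      destruct (Rlt_or_le (1 - r ^ 2) 0) as [Hl|Hl].
      * rewrite (Rabs_left _ Hl). destruct Heps as [->| ->];
          [right|left]; field; lra.
      * rewrite Rabs_right by lra. destruct Heps as [->| ->];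
          [left|right]; field; lra.
    + pose proof (Hf1 u Hu) as Hfu. pose proof (Hk2 v Hv) as Hkv.
      pose proof (mer_f0 _ _ _ M u Hu) as Hf0.
      pose proof (Hk0 v Hv) as Hkv0. fold kappa in Hkv0.
      exists (2 * (s1 * f u) / (s2 * kappa v * nu)). split.
      * apply Rdiv_lt_0_compat; [lra|]. now apply Rmult_lt_0_compat.
      * rewrite (HH u v Hu Hv), normal_vector_scal.
        pose proof (sign_nonzero _ Hs2) as Hs20.
        assert (E : 2 * (s1 * f u) / (s2 * kappa v * nu) * (kappa v / (2 * f u))
                    = s1 * s2 / nu).
        { transitivity (s1 / (s2 * nu)).
          - field. repeat split; auto; lra.
          - transitivity (s1 * s2 ^ 2 / (s2 * nu)).
            + rewrite (is_sign_square _ Hs2). field. split; auto; lra.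
            + field. split; auto; lra. }
        f_equal; [now rewrite E|].
        rewrite <- E. ring.
Qed.

(** As [kappa] has no zero, the coordinate [kappa / (2 f)] of [H] is constant
    in [u] only if [f] is. *)
Lemma not_parallel_of_nonconstant eps I J f g l n e z :
  meridian_surface eps I J f g l n e z ->
  (forall v, J v -> spherical_curvature l n v <> 0) ->
  (exists u1 u2, I u1 /\ I u2 /\ f u1 <> f u2) ->
  ~ parallel_mean_curvature I J z.
Proof.
  intros S Hk0 Hnc Hpar.
  pose proof (ms_frame _ _ _ _ _ _ _ _ _ S) as F.
  pose proof (ms_mer _ _ _ _ _ _ _ _ _ S) as M.
  destruct (derive_nonzero_of_nonconstant I f g M Hnc) as (u & Hu & Hd).
  pose proof (fr_int _ _ _ _ _ F) as (_ & (v & Hv) & _).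
  pose proof (mer_f0 _ _ _ M u Hu) as Hf0.
  assert (H2f : 2 * f u <> 0) by lra.
  destruct (smooth_derivatives I f u (mer_f _ _ _ M) Hu) as (F1 & _).
  pose proof (is_derive_bend I f g u M Hu) as M1.
  pose proof (Derive_correct _ _ (ex_derive_curvature eps J l n e v F Hv))
    as K1.
  pose proof (Hk0 v Hv) as Hkv.
  set (kappa := spherical_curvature l n) in *.
  destruct (normal_connection eps I J f g l n e z (mean_curvature z)
    (fun u v => kappa v / (2 * f u)) (fun u v => - eps * bend f g u / (2 * f u))
    u v ((0 * (2 * f u) - kappa v * (0 * f u + 2 * Derive f u))
        / (2 * f u) ^ 2) (Derive (fun s => - eps * bend f g s / (2 * f s)) u)
    ((Derive kappa v * (2 * f u) - kappa v * 0) / (2 * f u) ^ 2) 0 S Hu Hv)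
    as [HDu _].
  - intros s t Hs Ht. apply (mean_curvature_formula eps I J); auto.
  - derive_to. reflexivity.
  - apply Derive_correct. eexists.
    apply (is_derive_quot (fun s => - eps * bend f g s) (fun s => 2 * f s));
      [|derive_rules|exact H2f].
    apply (is_derive_times (fun _ => - eps) (bend f g) u);
      [apply is_derive_cst|exact M1].
  - apply (is_derive_quot kappa (fun _ => 2 * f u)); auto.
    apply is_derive_cst.
  - apply is_derive_cst.
  - destruct (Hpar u v Hu Hv) as [Zu _]. rewrite HDu in Zu.
    apply (normal_vector_zero eps I J f g l n e z u v _ _ S Hu Hv) in Zu.
    destruct Zu as [Zu _]. apply Hd.
    apply (Rmult_eq_reg_l (- kappa v / (2 * f u ^ 2))).
    2:{ apply Rmult_integral_contrapositive_currified; [lra|].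
        apply Rinv_neq_0_compat. apply Rmult_integral_contrapositive_currified;
          [lra|]. now apply pow_nonzero. }
    rewrite Rmult_0_r, <- Zu. field; auto.
Qed.

Lemma parallel_of_constant_data eps I J f g l n e z :
  meridian_surface eps I J f g l n e z ->
  (forall u1 u2, I u1 -> I u2 -> f u1 = f u2) ->
  (forall u1 u2, I u1 -> I u2 -> bend f g u1 = bend f g u2) ->
  (forall v1 v2, J v1 -> J v2 ->
     spherical_curvature l n v1 = spherical_curvature l n v2) ->
  parallel_mean_curvature I J z.
Proof.
  intros S Hf Hb Hk.
  pose proof (mer_int _ _ _ (ms_mer _ _ _ _ _ _ _ _ _ S))
    as (_ & (u0 & Hu0) & _).
  pose proof (fr_int _ _ _ _ _ (ms_frame _ _ _ _ _ _ _ _ _ S))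
    as (_ & (v0 & Hv0) & _).
  apply (parallel_of_constant eps I J f g l n e z _
    (spherical_curvature l n v0 / (2 * f u0)) (- eps * bend f g u0 / (2 * f u0))
    S).
  intros u v Hu Hv.
  rewrite (mean_curvature_formula eps I J f g l n e z u v S Hu Hv).
  now rewrite (Hf u u0 Hu Hu0), (Hb u u0 Hu Hu0), (Hk v v0 Hv Hv0).
Qed.

(** The classification for both types at once.  When [r = 0] the meridian is a
    catenary; otherwise [kappa] and [bend] are constant, so [f] cannot be
    constant unless [H] is parallel. *)
Lemma meridian_surface_classification eps I J f g l n e z :
  meridian_surface eps I J f g l n e z ->
  (forall v, J v -> spherical_curvature l n v <> 0) ->
  (parallel_normalized_mean_curvature I J z /\
   ~ parallel_mean_curvature I J z
   <-> case_i I J f g (spherical_curvature l n) \/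
       case_ii I J f g (spherical_curvature l n)).
Proof.
  intros S Hk0.
  pose proof (ms_frame _ _ _ _ _ _ _ _ _ S) as F.
  pose proof (ms_mer _ _ _ _ _ _ _ _ _ S) as M.
  pose proof (mer_int _ _ _ M) as (_ & (u0 & Hu0) & _).
  pose proof (fr_int _ _ _ _ _ F) as (_ & (v0 & Hv0) & _).
  pose proof (Hk0 v0 Hv0) as Hk00.
  set (kappa := spherical_curvature l n) in *.
  split.
  - intros [Hpn Hnp].
    destruct (proportional_of_parallel_normalized eps I J f g l n e z S Hk0 Hpn)
      as (r & Hr & Hprop). fold kappa in Hprop.
    destruct (Req_dec r 0) as [Hr0|Hr0].
    + left. split; [exact Hk0|].
      apply (catenary_of_bend_zero I f g M). intros u Hu.
      rewrite (Hprop u v0 Hu Hv0), Hr0. ring.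
    + right.
      assert (Hk : forall v, J v -> kappa v = kappa v0).
      { intros v Hv. apply (Rmult_eq_reg_l r); auto.
        now rewrite <- (Hprop u0 v Hu0 Hv), <- (Hprop u0 v0 Hu0 Hv0). }
      assert (Hnc : exists u1 u2, I u1 /\ I u2 /\ f u1 <> f u2).
      { apply NNPP. intros Hn. apply Hnp.
        apply (parallel_of_constant_data eps I J f g l n e z S).
        - intros u1 u2 H1 H2. apply NNPP. intros Hne. apply Hn.
          now exists u1, u2.
        - intros u1 u2 H1 H2.
          now rewrite (Hprop u1 v0 H1 Hv0), (Hprop u2 v0 H2 Hv0).
        - intros v1 v2 H1 H2. fold kappa. now rewrite (Hk v1 H1), (Hk v2 H2). }
      destruct (phi_of_bend_constant I f g (- (r * kappa v0)) M) as (a & Ha).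
      { intros u Hu. rewrite (Hprop u v0 Hu Hv0). ring. }
      { exact Hnc. }
      exists a, (- (r * kappa v0)), (kappa v0).
      split; [|split; [exact Hk00|split; [|split; [exact Hk|exact Ha]]]].
      * apply Ropp_neq_0_compat.
        now apply Rmult_integral_contrapositive_currified.
      * intros H. apply Hr. apply (Rmult_eq_reg_r (kappa v0 ^ 2)).
        -- transitivity ((- (r * kappa v0)) ^ 2); [ring|].
           rewrite H. ring.
        -- now apply pow_nonzero.
  - intros H.
    assert (Hr : exists r, proportional_bend I J f g kappa r /\
      exists u1 u2, I u1 /\ I u2 /\ f u1 <> f u2).
    { destruct H as [[_ Hc]|(a & c & k & Hc & Hk & Hck & Hkk & Hphi)].
      - destruct (bend_zero_of_catenary I f g M Hc) as [Hb Hnc].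
        exists 0. split; [|exact Hnc]. split; [lra|].
        intros u v Hu Hv. rewrite (Hb u Hu). ring.
      - destruct (bend_constant_of_phi I f g a c M Hphi) as (s & Hs & Hb).
        exists (s * c / k). split; [|exact (proj1 Hphi)]. split.
        + intros H1. apply Hck.
          transitivity ((s * c / k) ^ 2 * k ^ 2); [|rewrite H1; ring].
          transitivity (s ^ 2 * c ^ 2); [|field; auto].
          rewrite (is_sign_square _ Hs). ring.
        + intros u v Hu Hv. rewrite (Hb u Hu), (Hkk v Hv). field; auto. }
    destruct Hr as (r & Hr & Hnc). split.
    + exact (parallel_normalized_of_proportional _ _ _ _ _ _ _ _ _ r S Hk0 Hr).
    + apply (not_parallel_of_nonconstant eps I J f g l n e z S Hk0 Hnc).
Qed.

(** * The two types of spherical curves *)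

Definition twice_derivable_on (J : R -> Prop) (h : R -> R) : Prop :=
  forall v, J v -> ex_derive h v /\ ex_derive (Derive h) v.

Lemma twice_of_smooth (J : R -> Prop) (h : R -> R) :
  smooth_on J h -> twice_derivable_on J h.
Proof.
  intros Hh v Hv. split; [exact (Hh 1%nat v Hv)|exact (Hh 2%nat v Hv)].
Qed.

Lemma twice_derivable_times (J : R -> Prop) (h k : R -> R) :
  is_open_interval J -> twice_derivable_on J h -> twice_derivable_on J k ->
  twice_derivable_on J (fun v => h v * k v).
Proof.
  intros HJ Hh Hk.
  assert (H1 : forall v, J v -> is_derive (fun v => h v * k v) v
    (Derive h v * k v + h v * Derive k v)).
  { intros v Hv. apply is_derive_times; apply Derive_correct.
    - apply (Hh v Hv).
    - apply (Hk v Hv). }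
  intros v Hv. split; [eexists; apply (H1 v Hv)|].
  destruct (Hh v Hv) as [Hh1 Hh2]. destruct (Hk v Hv) as [Hk1 Hk2].
  apply Derive_correct in Hh1, Hh2, Hk1, Hk2.
  eexists. apply (is_derive_congr J
    (fun v => Derive h v * k v + h v * Derive k v)); auto.
  - intros t Ht. symmetry. apply is_derive_unique. now apply H1.
  - derive_rules.
Qed.

Lemma twice_derivable_comp (J : R -> Prop) (p p' p'' w : R -> R) :
  is_open_interval J -> (forall x, is_derive p x (p' x)) ->
  (forall x, is_derive p' x (p'' x)) -> twice_derivable_on J w ->
  twice_derivable_on J (fun v => p (w v)).
Proof.
  intros HJ Hp Hp' Hw.
  assert (Hc : forall q q' : R -> R, (forall x, is_derive q x (q' x)) ->
    forall v, J v -> is_derive (fun v => q (w v)) v (Derive w v * q' (w v))).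
  { intros q q' Hq v Hv.
    apply (is_derive_comp (K := R_AbsRing) (V := R_NormedModule) q w v _ _
      (Hq (w v))). apply Derive_correct. apply (Hw v Hv). }
  intros v Hv. split; [eexists; apply (Hc p p' Hp v Hv)|].
  pose proof (Hc p' p'' Hp' v Hv) as H2.
  destruct (Hw v Hv) as [_ Hw2]. apply Derive_correct in Hw2.
  eexists. apply (is_derive_congr J (fun v => Derive w v * p' (w v))); auto.
  - intros t Ht. symmetry. apply is_derive_unique. now apply Hc.
  - derive_rules.
Qed.

Lemma is_derive_sinh (x : R) : is_derive sinh x (cosh x).
Proof. apply is_derive_Reals. apply derivable_pt_lim_sinh. Qed.

Lemma is_derive_cosh (x : R) : is_derive cosh x (sinh x).
Proof. apply is_derive_Reals. apply derivable_pt_lim_cosh. Qed.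

Lemma cosh_square (x : R) : cosh x ^ 2 = 1 + sinh x ^ 2.
Proof.
  unfold cosh, sinh.
  assert (H : exp x * exp (- x) = 1).
  { rewrite <- exp_plus, Rplus_opp_r. apply exp_0. }
  transitivity (exp x * exp (- x) + ((exp x - exp (- x)) / 2) ^ 2);
    [field | rewrite H; ring].
Qed.

Lemma sin_square (x : R) : sin x ^ 2 = 1 - cos x ^ 2.
Proof. pose proof (sin2_cos2 x) as H. unfold Rsqr in H. lra. Qed.

(** In coordinates of signature (2,1), the square of the determinant of an
    orthogonal triple is minus the determinant of its Gram matrix.  When the
    first two vectors have squares [-1] and [1], it equals the square of the
    third vector, which is thus positive, and the triple is a basis. *)
Lemma lorentz_orthonormal_triple (l1 l2 l3 t1 t2 t3 n1 n2 n3 : R) :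
  l1 * l1 + l2 * l2 - l3 * l3 = -1 -> t1 * t1 + t2 * t2 - t3 * t3 = 1 ->
  l1 * t1 + l2 * t2 - l3 * t3 = 0 -> l1 * n1 + l2 * n2 - l3 * n3 = 0 ->
  t1 * n1 + t2 * n2 - t3 * n3 = 0 ->
  n1 * n1 + n2 * n2 - n3 * n3 = 1 \/ n1 * n1 + n2 * n2 - n3 * n3 = -1 ->
  n1 * n1 + n2 * n2 - n3 * n3 = 1 /\
  forall y1 y2 y3,
    y1 * l1 + y2 * l2 - y3 * l3 = 0 -> y1 * t1 + y2 * t2 - y3 * t3 = 0 ->
    y1 * n1 + y2 * n2 - y3 * n3 = 0 -> y1 = 0 /\ y2 = 0 /\ y3 = 0.
Proof.
  intros ll tt lt ln tn nn.
  set (D := l1 * (t2 * n3 - t3 * n2) - l2 * (t1 * n3 - t3 * n1)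
            + l3 * (t1 * n2 - t2 * n1)).
  set (N := n1 * n1 + n2 * n2 - n3 * n3) in *.
  assert (HD : D * D = N).
  { transitivity
      (- ((l1 * l1 + l2 * l2 - l3 * l3)
            * ((t1 * t1 + t2 * t2 - t3 * t3) * N
               - (t1 * n1 + t2 * n2 - t3 * n3) ^ 2)
          - (l1 * t1 + l2 * t2 - l3 * t3)
            * ((l1 * t1 + l2 * t2 - l3 * t3) * N
               - (t1 * n1 + t2 * n2 - t3 * n3)
                 * (l1 * n1 + l2 * n2 - l3 * n3))
          + (l1 * n1 + l2 * n2 - l3 * n3)
            * ((l1 * t1 + l2 * t2 - l3 * t3) * (t1 * n1 + t2 * n2 - t3 * n3)
               - (t1 * t1 + t2 * t2 - t3 * t3)
                 * (l1 * n1 + l2 * n2 - l3 * n3)))).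
    - unfold D, N. ring.
    - rewrite ll, tt, lt, ln, tn. ring. }
  assert (HN : N = 1) by (pose proof (Rle_0_sqr D) as H; unfold Rsqr in H; lra).
  split; [exact HN|]. intros y1 y2 y3 yl yt yn.
  assert (D0 : D <> 0) by (intros H; rewrite H in HD; lra).
  repeat split; apply (Rmult_eq_reg_r D); auto; rewrite Rmult_0_l.
  - transitivity
      ((y1 * l1 + y2 * l2 - y3 * l3) * (t2 * n3 - t3 * n2)
       + (y1 * t1 + y2 * t2 - y3 * t3) * (n2 * l3 - n3 * l2)
       + (y1 * n1 + y2 * n2 - y3 * n3) * (l2 * t3 - l3 * t2)).
    + unfold D. ring.
    + rewrite yl, yt, yn. ring.
  - transitivity
      ((y1 * l1 + y2 * l2 - y3 * l3) * (t3 * n1 - t1 * n3)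
       + (y1 * t1 + y2 * t2 - y3 * t3) * (n3 * l1 - n1 * l3)
       + (y1 * n1 + y2 * n2 - y3 * n3) * (l3 * t1 - l1 * t3)).
    + unfold D. ring.
    + rewrite yl, yt, yn. ring.
  - transitivity
      (- ((y1 * l1 + y2 * l2 - y3 * l3) * (t1 * n2 - t2 * n1)
       + (y1 * t1 + y2 * t2 - y3 * t3) * (n1 * l2 - n2 * l1)
       + (y1 * n1 + y2 * n2 - y3 * n3) * (l1 * t2 - l2 * t1))).
    + unfold D. ring.
    + rewrite yl, yt, yn. ring.
Qed.

Definition twice_derivable_curve (J : R -> Prop) (c : R -> E42) : Prop :=
  twice_derivable_on J (fun t => x1 (c t)) /\
  twice_derivable_on J (fun t => x2 (c t)) /\
  twice_derivable_on J (fun t => x3 (c t)) /\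
  twice_derivable_on J (fun t => x4 (c t)).

Lemma twice_derivable_vderive (J : R -> Prop) (c : R -> E42) (v : R) :
  twice_derivable_curve J c -> J v ->
  is_vderive c v (vderive c v) /\
  is_vderive (vderive c) v (vderive (vderive c) v).
Proof.
  intros (H1 & H2 & H3 & H4) Hv.
  destruct (H1 v Hv) as [A1 B1], (H2 v Hv) as [A2 B2], (H3 v Hv) as [A3 B3],
    (H4 v Hv) as [A4 B4].
  split; refine (conj _ (conj _ (conj _ _))); apply Derive_correct; assumption.
Qed.

(** The last hypothesis is the algebra of a quadratic space of signature (2,2):
    in the orthogonal of [e], the squares of two vectors of an orthonormal
    triple determine the third, and the triple is complete. *)
Lemma frame_of_orthonormal (eps : R) (J : R -> Prop) (l n : R -> E42)
  (e : E42) :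
  is_sign eps -> is_open_interval J -> twice_derivable_curve J l ->
  smooth_curve_on J n ->
  (forall v, J v -> inner (l v) (l v) = - eps) ->
  (forall v, J v -> inner (vderive l v) (vderive l v) = eps) ->
  inner e e = - eps ->
  (forall v, J v -> inner (l v) e = 0) ->
  (forall v, J v -> inner (n v) e = 0) ->
  (forall v, J v -> orthonormal3 (l v) (vderive l v) (n v)) ->
  (forall p q r, inner p e = 0 -> inner q e = 0 -> inner r e = 0 ->
     orthonormal3 p q r -> inner p p = - eps -> inner q q = eps ->
     inner r r = eps /\
     forall y, inner y p = 0 -> inner y q = 0 -> inner y r = 0 ->
       inner y e = 0 -> y = zero) ->
  frame eps J l n e.
Proof.
  intros Heps HJ Hl (N1 & N2 & N3 & N4) Hll Htt Hee Hle Hne Horth Hbasis.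
  assert (Hn : twice_derivable_curve J n)
    by (refine (conj _ (conj _ (conj _ _))); now apply twice_of_smooth).
  assert (Hte : forall v, J v -> inner (vderive l v) e = 0).
  { intros v Hv.
    pose proof (derive_inner_constant J l (fun _ => e) 0 v _ _ HJ Hv Hle
      (proj1 (twice_derivable_vderive J l v Hl Hv)) (is_vderive_const e v))
      as H.
    rewrite (inner_comm _ zero), inner_zero_l in H. lra. }
  assert (Hb : forall v, J v -> inner (n v) (n v) = eps /\
     forall y, inner y (l v) = 0 -> inner y (vderive l v) = 0 ->
       inner y (n v) = 0 -> inner y e = 0 -> y = zero)
    by (intros v Hv; apply Hbasis; auto).
  constructor; auto; try (intros v Hv;
    first [ apply (twice_derivable_vderive J l v Hl Hv)
          | apply (twice_derivable_vderive J n v Hn Hv)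
          | apply (Horth v Hv) | apply (Hb v Hv) ]).
  intros v y Hv. apply (Hb v Hv).
Qed.

Lemma l_M2_coordinates (w1 w2 : R -> R) (v : R) :
  l_M2 w1 w2 v
  = vec (sinh (w1 v) * cos (w2 v)) (sinh (w1 v) * sin (w2 v)) (cosh (w1 v)) 0.
Proof. unfold l_M2, e1, e2, e3. vec_unfold; ring. Qed.

Lemma l_Mt1_coordinates (w1 w2 : R -> R) (v : R) :
  l_Mt1 w1 w2 v
  = vec 0 (cosh (w1 v)) (sinh (w1 v) * cos (w2 v)) (sinh (w1 v) * sin (w2 v)).
Proof. unfold l_Mt1, e2, e3, e4. vec_unfold; ring. Qed.

Lemma twice_derivable_coordinates (J : R -> Prop) (w1 w2 : R -> R) :
  is_open_interval J -> smooth_on J w1 -> smooth_on J w2 ->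
  twice_derivable_on J (fun v => sinh (w1 v) * cos (w2 v)) /\
  twice_derivable_on J (fun v => sinh (w1 v) * sin (w2 v)) /\
  twice_derivable_on J (fun v => cosh (w1 v)) /\
  twice_derivable_on J (fun _ => 0).
Proof.
  intros HJ H1 H2. apply twice_of_smooth in H1, H2.
  pose proof (twice_derivable_comp J sinh cosh sinh w1 HJ is_derive_sinh
    is_derive_cosh H1).
  pose proof (twice_derivable_comp J cosh sinh cosh w1 HJ is_derive_cosh
    is_derive_sinh H1).
  assert (is_derive_msin : forall x, is_derive (fun y => - sin y) x (- cos x))
    by (intros x; apply is_derive_neg; apply is_derive_sin).
  pose proof (twice_derivable_comp J sin cos (fun x => - sin x) w2 HJ
    is_derive_sin is_derive_cos H2).
  pose proof (twice_derivable_comp J cos (fun x => - sin x) (fun x => - cos x)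
    w2 HJ is_derive_cos is_derive_msin H2).
  split; [|split; [|split]]; auto using twice_derivable_times.
  intros v Hv. split; eexists; [apply is_derive_cst|].
  apply (is_derive_ext (fun _ => 0)); [|apply is_derive_cst].
  intros t. symmetry. apply Derive_const.
Qed.

Lemma twice_derivable_ext (J : R -> Prop) (h k : R -> R) :
  (forall v, h v = k v) -> twice_derivable_on J h -> twice_derivable_on J k.
Proof.
  intros Hhk Hh v Hv. destruct (Hh v Hv) as [H1 H2]. split.
  - now apply (ex_derive_ext h).
  - apply (ex_derive_ext (Derive h)); [|exact H2].
    intros t. now apply Derive_ext.
Qed.

Lemma frame_M2 (J : R -> Prop) (w1 w2 : R -> R) (n : R -> E42) :
  is_open_interval J -> smooth_on J w1 -> smooth_on J w2 ->
  (forall v, J v ->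
     inner (vderive (l_M2 w1 w2) v) (vderive (l_M2 w1 w2) v) = 1) ->
  spherical_normal (in_span3 e1 e2 e3) J (l_M2 w1 w2) n ->
  frame 1 J (l_M2 w1 w2) n e4.
Proof.
  intros HJ H1 H2 Htt (Hn & Hnv).
  destruct (twice_derivable_coordinates J w1 w2 HJ H1 H2)
    as (Csc & Css & Cc & C0).
  apply frame_of_orthonormal; auto.
  - now left.
  - refine (conj _ (conj _ (conj _ _))).
    + apply (twice_derivable_ext J _ _
        (fun v => eq_sym (f_equal x1 (l_M2_coordinates w1 w2 v))) Csc).
    + apply (twice_derivable_ext J _ _
        (fun v => eq_sym (f_equal x2 (l_M2_coordinates w1 w2 v))) Css).
    + apply (twice_derivable_ext J _ _
        (fun v => eq_sym (f_equal x3 (l_M2_coordinates w1 w2 v))) Cc).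
    + apply (twice_derivable_ext J _ _
        (fun v => eq_sym (f_equal x4 (l_M2_coordinates w1 w2 v))) C0).
  - intros v _. rewrite l_M2_coordinates. unfold inner; cbn.
    transitivity (sinh (w1 v) ^ 2 * (cos (w2 v) ^ 2 + sin (w2 v) ^ 2)
                  - cosh (w1 v) ^ 2); [ring|].
    rewrite sin_square, cosh_square. ring.
  - unfold inner; cbn; ring.
  - intros v _. rewrite l_M2_coordinates. unfold inner; cbn; ring.
  - intros v Hv. destruct (Hnv v Hv) as [(a & b & c & ->) _].
    unfold inner; cbn; unfold mult; cbn; ring.
  - intros v Hv. apply (Hnv v Hv).
  - intros [[[p1 p2] p3] p4] [[[q1 q2] q3] q4] [[[r1 r2] r3] r4].
    unfold orthonormal3, unit_vector, inner; cbn.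
    intros Hp Hq Hr (_ & _ & Hru & Hpq & Hpr & Hqr) Hpp Hqq.
    assert (p4 = 0) by lra. assert (q4 = 0) by lra. assert (r4 = 0) by lra.
    subst p4 q4 r4.
    destruct (lorentz_orthonormal_triple p1 p2 p3 q1 q2 q3 r1 r2 r3)
      as [HN HB]; try lra.
    split; [lra|]. intros [[[y1 y2] y3] y4]; cbn. intros Hyp Hyq Hyr Hye.
    destruct (HB y1 y2 y3) as (-> & -> & ->); try lra.
    apply vec_ext; cbn; lra.
Qed.

Lemma frame_Mt1 (J : R -> Prop) (w1 w2 : R -> R) (n : R -> E42) :
  is_open_interval J -> smooth_on J w1 -> smooth_on J w2 ->
  (forall v, J v ->
     inner (vderive (l_Mt1 w1 w2) v) (vderive (l_Mt1 w1 w2) v) = -1) ->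
  spherical_normal (in_span3 e2 e3 e4) J (l_Mt1 w1 w2) n ->
  frame (-1) J (l_Mt1 w1 w2) n e1.
Proof.
  intros HJ H1 H2 Htt (Hn & Hnv).
  destruct (twice_derivable_coordinates J w1 w2 HJ H1 H2)
    as (Csc & Css & Cc & C0).
  apply frame_of_orthonormal; auto.
  - now right.
  - refine (conj _ (conj _ (conj _ _))).
    + apply (twice_derivable_ext J _ _
        (fun v => eq_sym (f_equal x1 (l_Mt1_coordinates w1 w2 v))) C0).
    + apply (twice_derivable_ext J _ _
        (fun v => eq_sym (f_equal x2 (l_Mt1_coordinates w1 w2 v))) Cc).
    + apply (twice_derivable_ext J _ _
        (fun v => eq_sym (f_equal x3 (l_Mt1_coordinates w1 w2 v))) Csc).
    + apply (twice_derivable_ext J _ _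
        (fun v => eq_sym (f_equal x4 (l_Mt1_coordinates w1 w2 v))) Css).
  - intros v _. rewrite l_Mt1_coordinates. unfold inner; cbn.
    transitivity (cosh (w1 v) ^ 2
      - sinh (w1 v) ^ 2 * (cos (w2 v) ^ 2 + sin (w2 v) ^ 2)); [ring|].
    rewrite sin_square, cosh_square. ring.
  - unfold inner; cbn; ring.
  - intros v _. rewrite l_Mt1_coordinates. unfold inner; cbn; ring.
  - intros v Hv. destruct (Hnv v Hv) as [(a & b & c & ->) _].
    unfold inner; cbn; unfold mult; cbn; ring.
  - intros v Hv. apply (Hnv v Hv).
  - intros [[[p1 p2] p3] p4] [[[q1 q2] q3] q4] [[[r1 r2] r3] r4].
    unfold orthonormal3, unit_vector, inner; cbn.
    intros Hp Hq Hr (_ & _ & Hru & Hpq & Hpr & Hqr) Hpp Hqq.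
    assert (p1 = 0) by lra. assert (q1 = 0) by lra. assert (r1 = 0) by lra.
    subst p1 q1 r1.
    (* For the opposite metric, [e2] is the timelike direction and [p] is the
       timelike vector of the triple. *)
    destruct (lorentz_orthonormal_triple p3 p4 p2 q3 q4 q2 r3 r4 r2)
      as [HN HB]; try lra.
    split; [lra|]. intros [[[y1 y2] y3] y4]; cbn. intros Hyp Hyq Hyr Hye.
    destruct (HB y3 y4 y2) as (-> & -> & ->); try lra.
    apply vec_ext; cbn; lra.
Qed.

(** * The classification *)

Theorem theorem5p3 (I J : R -> Prop) (f g w1 w2 : R -> R) (n : R -> E42)
  (hI : is_open_interval I) (hJ : is_open_interval J)
  (hf : smooth_on I f) (hg : smooth_on I g)
  (hw1 : smooth_on J w1) (hw2 : smooth_on J w2)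
  (hf0 : forall u, I u -> f u <> 0)
  (harc : forall u, I u -> Derive f u ^ 2 + Derive g u ^ 2 = 1)
  (hg0 : forall u, I u -> Derive g u <> 0) :
  (let l := l_M2 w1 w2 in
   let z := z_M2 f g w1 w2 in
   let kappa := spherical_curvature l n in
   (forall v, J v -> inner (vderive l v) (vderive l v) = 1) ->
   spherical_normal (in_span3 e1 e2 e3) J l n ->
   (forall v, J v -> kappa v <> 0) ->
   (parallel_normalized_mean_curvature I J z /\
    ~ parallel_mean_curvature I J z
    <-> case_i I J f g kappa \/ case_ii I J f g kappa)) /\
  (let l := l_Mt1 w1 w2 in
   let z := z_Mt1 f g w1 w2 in
   let kappa := spherical_curvature l n in
   (forall v, J v -> inner (vderive l v) (vderive l v) = -1) ->
   spherical_normal (in_span3 e2 e3 e4) J l n ->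
   (forall v, J v -> kappa v <> 0) ->
   (parallel_normalized_mean_curvature I J z /\
    ~ parallel_mean_curvature I J z
    <-> case_i I J f g kappa \/ case_ii I J f g kappa)).
Proof.
  assert (M : meridian I f g) by now constructor.
  split; intros l z kappa Htt Hn Hk.
  - apply (meridian_surface_classification 1 I J f g l n e4 z); auto.
    constructor; [exact M|now apply frame_M2|].
    intros u v. subst z l. unfold z_M2. generalize (l_M2 w1 w2). intros l.
    vec_unfold; ring.
  - apply (meridian_surface_classification (-1) I J f g l n e1 z); auto.
    constructor; [exact M|now apply frame_Mt1|].
    intros u v. subst z l. unfold z_Mt1. generalize (l_Mt1 w1 w2). intros l.
    vec_unfold; ring.
Qed.
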